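(* Fix $l\ge0$ and measurements $\boldsymbol{y}_0,\dots,\boldsymbol{y}_l$ of the linear Gaussian state-space model of the context. Consider the quadratic optimization, over the chain graph with nodes $0,1,\dots,l+1$ and edges $(i,i+1)$, $i=0,\dots,l$, in the variables $\boldsymbol{x}_i=[\boldsymbol{u}_i^T,\boldsymbol{z}_i^T]^T$, $$\min \sum_{i=0}^l g_i(\boldsymbol{z}_i,\boldsymbol{u}_i)\quad\text{s.t. } \begin{bmatrix}\boldsymbol{0}&\boldsymbol{I}\end{bmatrix}\begin{bmatrix}\boldsymbol{u}_{i+1}\\ \boldsymbol{z}_{i+1}\end{bmatrix}+\begin{bmatrix}-\boldsymbol{G}_i&-\boldsymbol{F}_i\end{bmatrix}\begin{bmatrix}\boldsymbol{u}_i\\ \boldsymbol{z}_i\end{bmatrix}=\boldsymbol{0},\quad i=0,\dots,l,$$ with root node $l+1$, where $g_i(\boldsymbol{z}_i,\boldsymbol{u}_i)=\frac12\boldsymbol{u}_i^T\boldsymbol{Q}_i^{-1}\boldsymbol{u}_i+\frac12(\boldsymbol{y}_i-\boldsymbol{H}_i\boldsymbol{z}_i)^T\boldsymbol{R}_i^{-1}(\boldsymbol{y}_i-\boldsymbol{H}_i\boldsymbol{z}_i)$ for $i=1,\dots,l$, and $g_0(\boldsymbol{z}_0,\boldsymbol{u}_0)$ is given by the same formula with $i=0$ plus the term $\frac12\boldsymbol{z}_0^T\boldsymbol{\Pi}_0^{-1}\boldsymbol{z}_0$. Let $\boldsymbol{P}_{-1,0}=\boldsymbol{\Pi}_0$ and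 $$\boldsymbol{P}_{i,i+1}=\begin{bmatrix}\boldsymbol{G}_i&\boldsymbol{F}_i\end{bmatrix}\boldsymbol{J}_i^{-1}\begin{bmatrix}\boldsymbol{G}_i^T\\ \boldsymbol{F}_i^T\end{bmatrix},\qquad \boldsymbol{J}_i=\begin{bmatrix}\boldsymbol{Q}_i^{-1}&\boldsymbol{0}\\ \boldsymbol{0}&\boldsymbol{H}_i^T\boldsymbol{R}_i^{-1}\boldsymbol{H}_i+\boldsymbol{P}_{i-1,i}^{-1}\end{bmatrix},\qquad i=0,\dots,l.$$ Then the messages $\{\boldsymbol{m}_{i\rightarrow i+1}^\star\mid i=0,\dots,l\}$ generated by the forward computation of asynchronous PDMM on this chain (described in the context), with the initial message $\boldsymbol{m}_{-1\rightarrow0}^\star=\boldsymbol{0}$, can be computed recursively as $$\boldsymbol{m}_{i\rightarrow i+1}^\star=(\boldsymbol{F}_i-\boldsymbol{K}_i\boldsymbol{H}_i)\boldsymbol{m}_{i-1\rightarrow i}^\star+\boldsymbol{K}_i\boldsymbol{y}_i=\hat{\boldsymbol{z}}_{i+1|i}^\star,\qquad i=0,\dots,l,$$ where $\boldsymbol{K}_i$ is the Kalman gain and $\hat{\boldsymbol{z}}_{i+1|i}^\star$ the Kalman filter estimate.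
   Context: State-space model. $\boldsymbol{z}_{l+1}=\boldsymbol{F}_l\boldsymbol{z}_l+\boldsymbol{G}_l\boldsymbol{u}_l$ and $\boldsymbol{y}_l=\boldsymbol{H}_l\boldsymbol{z}_l+\boldsymbol{v}_l$ for $l\ge0$, with known real matrices $\boldsymbol{F}_l$ ($n\times n$), $\boldsymbol{G}_l$ ($n\times r$), $\boldsymbol{H}_l$ ($q\times n$), where each $[\boldsymbol{F}_l\ \boldsymbol{G}_l]$ has full row rank. $\{\boldsymbol{u}_l\}$ and $\{\boldsymbol{v}_l\}$ are zero-mean white Gaussian processes, mutually uncorrelated (hence, jointly Gaussian, independent), with $E[\boldsymbol{u}_l\boldsymbol{u}_j^T]=\boldsymbol{Q}_l\delta_{lj}$, $E[\boldsymbol{v}_l\boldsymbol{v}_j^T]=\boldsymbol{R}_l\delta_{lj}$, $E[\boldsymbol{u}_l\boldsymbol{v}_j^T]=\boldsymbol{0}$, $\boldsymbol{Q}_l\succ0$, $\boldsymbol{R}_l\succ0$. $\boldsymbol{z}_0$ is Gaussian with zero mean and covariance $\boldsymbol{\Pi}_0\succ0$, independent of $\{\boldsymbol{u}_l\}$ and $\{\boldsymbol{v}_l\}$. Kalman filter. $\hat{\boldsymbol{z}}_{l+1|l}^\star=E[\boldsymbol{z}_{l+1}\mid \boldsymbol{y}_0,\dots,\boldsymbol{y}_l]$, $\hat{\boldsymbol{z}}_{0|-1}^\star=\boldsymbol{0}$, and $\boldsymbol{D}_l=E[(\boldsymbol{z}_l-\hat{\boldsymbol{z}}_{l|l-1}^\star)(\boldsymbol{z}_l-\hat{\boldsymbol{z}}_{l|l-1}^\star)^T]$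 with $\boldsymbol{D}_0=\boldsymbol{\Pi}_0$. The Kalman filter computes these for $l\ge0$ by $$\hat{\boldsymbol{z}}_{l+1|l}^\star=(\boldsymbol{F}_l-\boldsymbol{K}_l\boldsymbol{H}_l)\hat{\boldsymbol{z}}_{l|l-1}^\star+\boldsymbol{K}_l\boldsymbol{y}_l,\qquad \boldsymbol{K}_l=\boldsymbol{F}_l\boldsymbol{D}_l\boldsymbol{H}_l^T(\boldsymbol{H}_l\boldsymbol{D}_l\boldsymbol{H}_l^T+\boldsymbol{R}_l)^{-1},$$ $$\boldsymbol{D}_{l+1}=\boldsymbol{F}_l\boldsymbol{D}_l\boldsymbol{F}_l^T+\boldsymbol{G}_l\boldsymbol{Q}_l\boldsymbol{G}_l^T-\boldsymbol{K}_l(\boldsymbol{H}_l\boldsymbol{D}_l\boldsymbol{H}_l^T+\boldsymbol{R}_l)\boldsymbol{K}_l^T.$$ Forward computation of asynchronous PDMM. For a quadratic problem $\min\sum_i(\frac12\boldsymbol{x}_i^T\boldsymbol{\Sigma}_i\boldsymbol{x}_i-\boldsymbol{a}_i^T\boldsymbol{x}_i)$ s.t. $\boldsymbol{A}_{i|i+1}\boldsymbol{x}_i+\boldsymbol{A}_{i+1|i}\boldsymbol{x}_{i+1}=\boldsymbol{c}_{i,i+1}$ on the chain with nodes $0,\dots,l+1$, the forward computation with matrices $\boldsymbol{P}_{i,i+1}=\boldsymbol{P}_{i+1,i}$ is $$\boldsymbol{m}_{0\rightarrow1}^\star=\boldsymbol{c}_{01}-2\boldsymbol{A}_{0|1}\big(\boldsymbol{\Sigma}_0+\boldsymbol{A}_{0|1}^T\boldsymbol{P}_{01}^{-1}\boldsymbol{A}_{0|1}\big)^{-1}\boldsymbol{a}_0,$$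 $$\boldsymbol{m}_{i\rightarrow i+1}^\star=\boldsymbol{c}_{i,i+1}-2\boldsymbol{A}_{i|i+1}\Big(\boldsymbol{\Sigma}_i+\sum_{u\in\{i-1,i+1\}}\boldsymbol{A}_{i|u}^T\boldsymbol{P}_{iu}^{-1}\boldsymbol{A}_{i|u}\Big)^{-1}\big(\boldsymbol{a}_i+\boldsymbol{A}_{i|i-1}^T\boldsymbol{P}_{i-1,i}^{-1}\boldsymbol{m}_{i-1\rightarrow i}^\star\big),\quad i=1,\dots,l.$$ For the problem in the claim: $\boldsymbol{A}_{i|i+1}=[-\boldsymbol{G}_i\ \ -\boldsymbol{F}_i]$, $\boldsymbol{A}_{i+1|i}=[\boldsymbol{0}\ \ \boldsymbol{I}]$, $\boldsymbol{c}_{i,i+1}=\boldsymbol{0}$, $\boldsymbol{a}_i=[\boldsymbol{0}^T,(\boldsymbol{H}_i^T\boldsymbol{R}_i^{-1}\boldsymbol{y}_i)^T]^T$ for $i\le l$, $\boldsymbol{\Sigma}_i=\mathrm{diag}(\boldsymbol{Q}_i^{-1},\boldsymbol{H}_i^T\boldsymbol{R}_i^{-1}\boldsymbol{H}_i)$ for $1\le i\le l$, $\boldsymbol{\Sigma}_0=\mathrm{diag}(\boldsymbol{Q}_0^{-1},\boldsymbol{H}_0^T\boldsymbol{R}_0^{-1}\boldsymbol{H}_0+\boldsymbol{\Pi}_0^{-1})$ (block-diagonal), and no local function at node $l+1$. *)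

(* Defs.v *)
From mathcomp Require Export all_boot all_order all_algebra.
From mathcomp Require Export all_classical all_reals all_analysis.
From mathcomp Require Import ring.
Set Implicit Arguments.
Unset Strict Implicit.
Unset Printing Implicit Defensive.
Import Order.TTheory GRing.Theory Num.Theory.
Local Open Scope classical_set_scope.
Local Open Scope ring_scope.

Section LinearAlgebra.
Context {R : realType}.

Definition quad m (A : 'M[R]_m) (x : 'cV[R]_m) : R := (x^T *m A *m x) 0 0.

Definition posdef m (A : 'M[R]_m) : Prop :=
  A^T = A /\ forall x : 'cV[R]_m, x != 0 -> 0 < quad A x.

End LinearAlgebra.

Section Probability.
Context {R : realType} {d : measure_display} {Omega : measurableType d}.
Variable P : probability Omega R.

(* [normal_prob m 0] is not the Dirac mass at m, so the degenerate case is
   treated separately. *)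
Definition is_gaussian (X : Omega -> R) : Prop :=
  measurable_fun setT X /\
  exists m s : R,
    if s == 0 then {ae P, forall w, X w = m}
    else forall A : set R, measurable A -> P (X @^-1` A) = normal_prob m s A.

Definition jointly_gaussian (I : Type) (X : I -> Omega -> R) : Prop :=
  forall (s : seq I) (c : I -> R),
    is_gaussian (fun w => \sum_(i <- s) c i * X i w).

Definition sigma_of (I : Type) (X : I -> Omega -> R) : set (set Omega) :=
  <<s \bigcup_i preimage_set_system setT (X i) measurable >>.

Definition independent_sigma (A B : set (set Omega)) : Prop :=
  forall E F, A E -> B F -> P (E `&` F) = (P E * P F)%E.

Definition is_condexp (G : set (set Omega)) (X Y : Omega -> R) : Prop :=
  [/\ forall B : set R, measurable B -> G (Y @^-1` B),
      P.-integrable setT (EFin \o Y) &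
      forall A, G A ->
        (\int[P]_(w in A) (Y w)%:E = \int[P]_(w in A) (X w)%:E)%E].

(* A version of E[X | G], chosen among all of them (0 if there is none). *)
Definition condexp (G : set (set Omega)) (X : Omega -> R) : Omega -> R :=
  xget (cst 0) [set Y | is_condexp G X Y].

Definition coord m (X : Omega -> 'cV[R]_m) (i : 'I_m) : Omega -> R :=
  fun w => X w i 0.

Definition vmean m (X : Omega -> 'cV[R]_m) : 'cV[\bar R]_m :=
  \col_i ('E_P[coord X i])%E.

(* E[X Y^T] *)
Definition moment2 m p (X : Omega -> 'cV[R]_m) (Y : Omega -> 'cV[R]_p) :
    'M[\bar R]_(m, p) :=
  \matrix_(i, j) ('E_P[(fun w => coord X i w * coord Y j w)%R])%E.

End Probability.

Section StateSpaceModel.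
Context {R : realType} {n r q : nat}.

Record ssm := SSM {
  ssF : nat -> 'M[R]_n;
  ssG : nat -> 'M[R]_(n, r);
  ssH : nat -> 'M[R]_(q, n);
  ssQ : nat -> 'M[R]_r;
  ssR : nat -> 'M[R]_q;
  ssPi0 : 'M[R]_n }.

Record ssm_regular (M : ssm) : Prop := {
  ssm_full_rank : forall l, row_free (row_mx (ssF M l) (ssG M l));
  ssm_Q_posdef : forall l, posdef (ssQ M l);
  ssm_R_posdef : forall l, posdef (ssR M l);
  ssm_Pi0_posdef : posdef (ssPi0 M) }.

Context {d : measure_display} {Omega : measurableType d}.
Variable P : probability Omega R.

(* All the scalar components of all the u_l and v_l. *)
Definition noise (u : nat -> Omega -> 'cV[R]_r) (v : nat -> Omega -> 'cV[R]_q)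
    (k : (nat * 'I_r) + (nat * 'I_q)) : Omega -> R :=
  match k with
  | inl (l, i) => coord (u l) i
  | inr (l, i) => coord (v l) i
  end.

Record ssm_process (M : ssm) (z : nat -> Omega -> 'cV[R]_n)
    (u : nat -> Omega -> 'cV[R]_r) (v y : nat -> Omega -> 'cV[R]_q) : Prop := {
  state_eq : forall l w, z l.+1 w = ssF M l *m z l w + ssG M l *m u l w;
  output_eq : forall l w, y l w = ssH M l *m z l w + v l w;
  noise_gaussian : jointly_gaussian P (noise u v);
  u_mean : forall l, vmean P (u l) = const_mx 0%E;
  v_mean : forall l, vmean P (v l) = const_mx 0%E;
  u_cov : forall l j,
    moment2 P (u l) (u j) = map_mx EFin (ssQ M l *+ (l == j));
  v_cov : forall l j,
    moment2 P (v l) (v j) = map_mx EFin (ssR M l *+ (l == j));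
  uv_cov : forall l j, moment2 P (u l) (v j) = const_mx 0%E;
  z0_gaussian : jointly_gaussian P (coord (z 0%N));
  z0_mean : vmean P (z 0%N) = const_mx 0%E;
  z0_cov : moment2 P (z 0%N) (z 0%N) = map_mx EFin (ssPi0 M);
  z0_indep :
    independent_sigma P (sigma_of (coord (z 0%N))) (sigma_of (noise u v)) }.

Variables (M : ssm) (z : nat -> Omega -> 'cV[R]_n)
  (y : nat -> Omega -> 'cV[R]_q).

(* sigma(y_0, ..., y_l) *)
Definition sigma_obs (l : nat) : set (set Omega) :=
  sigma_of (fun k : 'I_l.+1 * 'I_q => coord (y k.1) k.2).

(* [kf_est k] is the estimate of z_k given y_0, ..., y_(k-1). *)
Definition kf_est (k : nat) (w : Omega) : 'cV[R]_n :=
  if k is l.+1 then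
    \col_i condexp P (sigma_obs l) (coord (z l.+1) i) w
  else 0.

Definition kf_err (k : nat) (w : Omega) : 'cV[R]_n := z k w - kf_est k w.

Definition kf_cov (k : nat) : 'M[R]_n :=
  map_mx fine (moment2 P (kf_err k) (kf_err k)).

Definition kf_gain (l : nat) : 'M[R]_(n, q) :=
  ssF M l *m kf_cov l *m (ssH M l)^T
  *m invmx (ssH M l *m kf_cov l *m (ssH M l)^T + ssR M l).

End StateSpaceModel.

Arguments ssm : clear implicits.

Section PDMM.
Context {R : realType} {m e : nat}.

(* Quadratic problem on the chain with nodes 0, ..., qp_len + 1; the fields are,
   at i: Sigma_i, a_i, A_{i|i+1}, A_{i+1|i} and c_{i,i+1}. *)
Record chain_qp := ChainQP {
  qp_len : nat;
  qpS : nat -> 'M[R]_m;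
  qpa : nat -> 'cV[R]_m;
  qpAf : nat -> 'M[R]_(e, m);
  qpAb : nat -> 'M[R]_(e, m);
  qpc : nat -> 'cV[R]_e }.

Definition qp_objective (pb : chain_qp) (x : nat -> 'cV[R]_m) : R :=
  \sum_(0 <= i < (qp_len pb).+2)
    (2^-1 * quad (qpS pb i) (x i) - ((qpa pb i)^T *m x i) 0 0).

Definition qp_feasible (pb : chain_qp) (x : nat -> 'cV[R]_m) : Prop :=
  forall i, (i <= qp_len pb)%N ->
    qpAf pb i *m x i + qpAb pb i *m x i.+1 = qpc pb i.

(* [pdmm_msg pb Pe i] is m_{i->i+1}, where [Pe i] is P_{i,i+1} = P_{i+1,i};
   only the values at i <= qp_len pb are messages of the chain. *)
Fixpoint pdmm_msg (pb : chain_qp) (Pe : nat -> 'M[R]_e) (i : nat) : 'cV[R]_e :=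
  match i with
  | 0%N =>
      qpc pb 0%N - 2 *: (qpAf pb 0%N
        *m invmx (qpS pb 0%N + (qpAf pb 0%N)^T *m invmx (Pe 0%N) *m qpAf pb 0%N)
        *m qpa pb 0%N)
  | j.+1 =>
      qpc pb j.+1 - 2 *: (qpAf pb j.+1
        *m invmx (qpS pb j.+1
                  + ((qpAb pb j)^T *m invmx (Pe j) *m qpAb pb j
                     + (qpAf pb j.+1)^T *m invmx (Pe j.+1) *m qpAf pb j.+1))
        *m (qpa pb j.+1
            + (qpAb pb j)^T *m invmx (Pe j) *m pdmm_msg pb Pe j))
  end.

(* m_{i-1->i}, with m_{-1->0} = 0 *)
Definition pdmm_in_msg (pb : chain_qp) (Pe : nat -> 'M[R]_e) (i : nat) :
    'cV[R]_e :=
  if i is j.+1 then pdmm_msg pb Pe j else 0.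

End PDMM.

Arguments chain_qp : clear implicits.

Section KalmanProblem.
Context {R : realType} {n r q : nat}.
Variable M : ssm R n r q.

Definition infoJ (B : 'M[R]_n) (i : nat) : 'M[R]_(r + n) :=
  block_mx (invmx (ssQ M i)) 0
           0 ((ssH M i)^T *m invmx (ssR M i) *m ssH M i + invmx B).

(* [edgeP i] is P_{i-1,i}. *)
Fixpoint edgeP (i : nat) : 'M[R]_n :=
  match i with
  | 0%N => ssPi0 M
  | j.+1 => row_mx (ssG M j) (ssF M j) *m invmx (infoJ (edgeP j) j)
            *m col_mx (ssG M j)^T (ssF M j)^T
  end.

Variables (y : nat -> 'cV[R]_q) (l : nat).

Definition local_cost (i : nat) (zi : 'cV[R]_n) (ui : 'cV[R]_r) : R :=
  2^-1 * quad (invmx (ssQ M i)) ui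
  + 2^-1 * quad (invmx (ssR M i)) (y i - ssH M i *m zi)
  + (if i == 0%N then 2^-1 * quad (invmx (ssPi0 M)) zi else 0).

(* The node variable is x_i = [u_i; z_i]. *)
Definition kalman_qp : chain_qp R (r + n) n := {|
  qp_len := l;
  qpS := fun i =>
    if (i <= l)%N then
      block_mx (invmx (ssQ M i)) 0
               0 ((ssH M i)^T *m invmx (ssR M i) *m ssH M i
                  + (if i == 0%N then invmx (ssPi0 M) else 0))
    else 0;
  qpa := fun i =>
    if (i <= l)%N then
      col_mx 0 ((ssH M i)^T *m invmx (ssR M i) *m y i)
    else 0;
  qpAf := fun i => row_mx (- ssG M i) (- ssF M i);
  qpAb := fun i => row_mx 0 1%:M;
  qpc := fun i => 0 |}.

Lemma quadD m (A B : 'M[R]_m) x : quad (A + B) x = quad A x + quad B x.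
Proof. by rewrite /quad mulmxDr mulmxDl mxE. Qed.

Lemma quad0 m (x : 'cV[R]_m) : quad 0 x = 0.
Proof. by rewrite /quad mulmx0 mul0mx mxE. Qed.

Lemma quad_diag (A : 'M[R]_r) (B : 'M[R]_n) ui zi :
  quad (block_mx A 0 0 B) (col_mx ui zi) = quad A ui + quad B zi.
Proof.
rewrite /quad tr_col_mx mul_row_block !mulmx0 addr0 add0r mul_row_col.
by rewrite mxE.
Qed.

(* [kalman_qp] is the minimization of the sum of the local costs: the two
   objectives differ by a constant. *)
Lemma kalman_qp_objective (u : nat -> 'cV[R]_r) (z : nat -> 'cV[R]_n) :
  (forall i, posdef (ssR M i)) ->
  qp_objective kalman_qp (fun i => col_mx (u i) (z i)) =
  \sum_(0 <= i < l.+1) local_cost i (z i) (u i)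
  - \sum_(0 <= i < l.+1) 2^-1 * quad (invmx (ssR M i)) (y i).
Proof.
move=> hR; rewrite /qp_objective big_nat_recr //= ltnn quad0 mulr0.
rewrite trmx0 mul0mx mxE subr0 addr0 -sumrB.
apply: eq_big_nat => i /andP[_]; rewrite ltnS => -> /=.
rewrite quad_diag quadD /local_cost tr_col_mx mul_row_col trmx0 mul0mx add0r.
have -> : quad (if i == 0%N then invmx (ssPi0 M) else 0) (z i) =
    (if i == 0%N then quad (invmx (ssPi0 M)) (z i) else 0).
  by case: ifP => // _; rewrite quad0.
set S := invmx (ssR M i); set H := ssH M i.
have symS : S^T = S by rewrite /S trmx_inv (hR i).1.
have Hq : quad (H^T *m S *m H) (z i) = quad S (H *m z i).
  by rewrite /quad trmx_mul !mulmxA.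
have Hl : ((H^T *m S *m y i)^T *m z i) 0 0 = ((y i)^T *m S *m (H *m z i)) 0 0.
  by rewrite !trmx_mul trmxK symS !mulmxA.
set b := y i; set a := H *m z i.
have Hs : (a^T *m S *m b) 0 0 = (b^T *m S *m a) 0 0.
  have -> : a^T *m S *m b = (b^T *m S *m a)^T.
    by rewrite !trmx_mul trmxK symS mulmxA.
  by rewrite mxE.
have Hy : quad S (b - a) = quad S b - 2 * (b^T *m S *m a) 0 0 + quad S a.
  have E : (b - a)^T *m S *m (b - a) = b^T *m S *m b - b^T *m S *m a
      - (a^T *m S *m b - a^T *m S *m a).
    by rewrite mulmxBr [(b - a)^T]raddfB /= !mulmxBl !opprD !opprK addrACA.
  rewrite /quad E; move: Hs; rewrite !mxE => ->.
  by ring.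
rewrite [X in _ - X]Hl Hy Hq -/a; by case: ifP => _; field; rewrite ?pnatr_eq0.
Qed.

Lemma kalman_qp_feasible (u : nat -> 'cV[R]_r) (z : nat -> 'cV[R]_n) :
  qp_feasible kalman_qp (fun i => col_mx (u i) (z i)) <->
  forall i, (i <= l)%N -> z i.+1 = ssF M i *m z i + ssG M i *m u i.
Proof.
have E i : row_mx (- ssG M i) (- ssF M i) *m col_mx (u i) (z i)
    + row_mx 0 1%:M *m col_mx (u i.+1) (z i.+1)
  = z i.+1 - (ssF M i *m z i + ssG M i *m u i).
  by rewrite !mul_row_col mul0mx mul1mx add0r !mulNmx -opprD addrC
             [ssG M i *m _ + _]addrC.
split=> h i il; have := h i il; rewrite /= ?E; first by move/subr0_eq.
by move=> ->; rewrite subrr.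
Qed.

End KalmanProblem.

(* Main.v *)
Require Import Defs.
From mathcomp Require Import ring lra measurable_realfun.
Set Implicit Arguments.
Unset Strict Implicit.
Unset Printing Implicit Defensive.
Import Order.TTheory GRing.Theory Num.Theory.
Import numFieldNormedType.Exports.
Local Open Scope classical_set_scope.
Local Open Scope ring_scope.

(** The Riccati recursion links a deterministic and a probabilistic statement.

    Deterministic side.  Put B = [G F] and let J be the information matrix at
    node i, so that P_{i,i+1} = B J^-1 B^T.  The matrix which PDMM inverts at
    node i is J + B^T P_{i,i+1}^-1 B, and
      B J^-1 (J + B^T P_{i,i+1}^-1 B) = B + P_{i,i+1} P_{i,i+1}^-1 B = 2 B,
    so the factor 2 of the message cancels ([pdmm_half]) and the message is
    B J^-1 applied to the information vector.  The Woodbury identities turn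
    this into one step of the Kalman filter whose prior covariance is
    P_{i-1,i} ([pdmm_msg_kalman]), and they turn the definition of P_{i,i+1}
    into the Riccati equation ([edgeP_riccati]).

    Probabilistic side.  The gain and the estimate of the theorem are defined
    from conditional expectations.  Run instead the linear recursion whose
    gains come from the matrices P_{i-1,i} ([kalman_rec]).  An induction on
    second moments ([err_cov]) shows that its error at time k has covariance
    P_{k-1,k} and is uncorrelated with y_0, ..., y_{k-1}.  For Gaussian
    variables this implies that the error integrates to 0 over every event of
    sigma(y_0, ..., y_{k-1}) ([gaussian_regression]), so the recursion is a
    version of the conditional expectation; versions agree almost everywhere,
    hence the covariance of the theorem is P_{k-1,k} and its gain is the one
    of the recursion.

    Uncorrelated implies orthogonal to all events.  Joint Gaussianity gives
    the laws of linear combinations only, and multivariate laws never appear.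
    Let X be uncorrelated with a space W of linear combinations f.
    - If X and S lie in a Gaussian space, E[X cos(S + c)] equals
      - sin c E[X S] E[cos S]: symmetry of the law kills the part of X which is
      uncorrelated with S, and the Stein identity (integration by parts
      against the normal density) evaluates the part along S
      ([gaussian_cos_phase]).
    - The initial state and the noise are independent, so by the addition
      formulas E[X cos(f + c)] = 0 for all f in W ([indep_gaussian_cos]).
    - The bounded functions g such that multiplication by g preserves the
      property that E[X h cos(f + c)] = 0 for all f and c form an algebra,
      closed under bounded pointwise limits, which contains the cosines.
      Polynomials in sines converge to indicators of half-lines, so the events
      whose indicator lies in the algebra form a sigma-algebra containing
      sigma(W), and E[X 1_A] = 0 for all of them ([trig_annihilates]). *)

(** * Expectations of real random variables *)

Section Expectation.
Context {R : realType} {d : measure_display} {Omega : measurableType d}.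
Variable P : probability Omega R.
Implicit Types f g h : Omega -> R.

Definition Ex f : R := \int[P]_w f w.

Definition integ f : Prop := P.-integrable setT (EFin \o f).

Definition bounded_rv f : Prop :=
  measurable_fun setT f /\ exists c : R, forall w, `|f w| <= c.

Definition L2 f : Prop := measurable_fun setT f /\ integ (fun w => f w ^+ 2).

Lemma integ_measurable f : integ f -> measurable_fun setT f.
Proof. by move=> /measurable_int /measurable_EFinP. Qed.

Lemma eq_Ex f g : f =1 g -> Ex f = Ex g.
Proof. by move=> fg; rewrite /Ex; congr Rintegral; apply/funext. Qed.

Lemma eq_integ f g : f =1 g -> integ f -> integ g.
Proof. by move=> /funext ->. Qed.

Lemma integD f g : integ f -> integ g -> integ (fun w => f w + g w).
Proof. by move=> hf hg; apply: (integrableD measurableT hf hg). Qed.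

Lemma integZ c f : integ f -> integ (fun w => c * f w).
Proof. by move=> hf; apply: (integrableZl measurableT c hf). Qed.

Lemma integB f g : integ f -> integ g -> integ (fun w => f w - g w).
Proof. by move=> hf hg; apply: (integrableB measurableT hf hg). Qed.

Lemma le_integ f g : measurable_fun setT f -> (forall w, `|f w| <= g w) ->
  integ g -> integ f.
Proof.
move=> mf fg hg; apply: le_integrable hg => //; first exact/measurable_EFinP.
by move=> w _ /=; rewrite lee_fin (le_trans (fg w))// ler_norm.
Qed.

Lemma integ_cst c : integ (fun=> c).
Proof. exact: finite_measure_integrable_cst. Qed.

Lemma bounded_integ f : bounded_rv f -> integ f.
Proof. by move=> [mf [c fc]]; apply: le_integ (integ_cst c). Qed.

Lemma integ_norm f : integ f -> integ (fun w => `|f w|).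
Proof. by move=> hf; apply: integrable_norm hf. Qed.

Lemma integM_bounded f g : integ f -> bounded_rv g ->
  integ (fun w => f w * g w).
Proof.
move=> hf [mg [c gc]].
apply: (@le_integ _ (fun w => c * `|f w|)).
- by apply: measurable_funM => //; exact: integ_measurable.
- by move=> w; rewrite normrM mulrC ler_wpM2r.
- exact/integZ/integ_norm.
Qed.

Lemma ExD f g : integ f -> integ g -> Ex (fun w => f w + g w) = Ex f + Ex g.
Proof. by move=> hf hg; rewrite /Ex RintegralD. Qed.

Lemma ExB f g : integ f -> integ g -> Ex (fun w => f w - g w) = Ex f - Ex g.
Proof. by move=> hf hg; rewrite /Ex RintegralB. Qed.

Lemma ExZ c f : integ f -> Ex (fun w => c * f w) = c * Ex f.
Proof. by move=> hf; rewrite /Ex RintegralZl. Qed.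

Lemma Ex_cst c : Ex (fun=> c) = c.
Proof. rewrite /Ex Rintegral_cst//=. by rewrite probability_setT mulr1. Qed.

Lemma EFin_Ex f : integ f -> (Ex f)%:E = (\int[P]_w (f w)%:E)%E.
Proof.
by move=> hf; rewrite /Ex /Rintegral fineK//; exact: integrable_fin_num.
Qed.

Lemma integ_sum (I : Type) (s : seq I) (F : I -> Omega -> R) :
  (forall i, integ (F i)) -> integ (fun w => \sum_(i <- s) F i w).
Proof.
move=> hF; elim: s => [|i s IH].
  by apply: (eq_integ _ (integ_cst 0)) => w; rewrite big_nil.
by apply: (eq_integ _ (integD (hF i) IH)) => w; rewrite big_cons.
Qed.

Lemma Ex_sum (I : Type) (s : seq I) (F : I -> Omega -> R) :
  (forall i, integ (F i)) ->
  Ex (fun w => \sum_(i <- s) F i w) = \sum_(i <- s) Ex (F i).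
Proof.
move=> hF; elim: s => [|i s IH].
  by rewrite big_nil -[RHS](Ex_cst 0); apply: eq_Ex => w; rewrite big_nil.
rewrite big_cons -IH -ExD//; last exact: integ_sum.
by apply: eq_Ex => w; rewrite big_cons.
Qed.

Lemma Ex_cvg (F : nat -> Omega -> R) f g :
  (forall k, measurable_fun setT (F k)) -> measurable_fun setT f -> integ g ->
  (forall k w, `|F k w| <= g w) -> (forall w, F ^~ w @ \oo --> f w) ->
  integ f /\ (fun k => Ex (F k)) @ \oo --> Ex f.
Proof.
move=> mF mf hg Fg Ff.
have [||||| i1 _ i3] := @dominated_convergence _ _ _ P setT measurableT
  (fun k => EFin \o F k) (EFin \o f) (EFin \o g).
- by move=> k; exact/measurable_EFinP.
- exact/measurable_EFinP.
- by apply/aeW => w _; apply: cvg_EFin (Ff w); exact: nearW.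
- exact: hg.
- by apply/aeW => w k _ /=; rewrite lee_fin.
split => //; apply: fine_cvg; rewrite EFin_Ex//.
Qed.

Lemma Ex_limit_eq0 (F : nat -> Omega -> R) f g :
  (forall k, measurable_fun setT (F k)) -> measurable_fun setT f -> integ g ->
  (forall k w, `|F k w| <= g w) -> (forall w, F ^~ w @ \oo --> f w) ->
  (forall k, Ex (F k) = 0) -> Ex f = 0.
Proof.
move=> mF mf hg Fg Ff E0; have [_ h] := Ex_cvg mF mf hg Fg Ff.
have /cvg_unique : (fun k => Ex (F k)) @ \oo --> (0 : R).
  by under eq_fun do rewrite E0; exact: cvg_cst.
by move=> /(_ (@norm_hausdorff _ _) _ h).
Qed.

(** Domination by f^2 + g^2 replaces the Cauchy-Schwarz inequality. *)
Lemma L2M f g : L2 f -> L2 g -> integ (fun w => f w * g w).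
Proof.
move=> [mf f2] [mg g2].
apply: (@le_integ _ (fun w => f w ^+ 2 + g w ^+ 2)); last exact: integD.
  exact: measurable_funM.
move=> w; rewrite ler_norml; apply/andP; split; nra.
Qed.

Lemma L2_cst c : L2 (fun=> c).
Proof. by split=> //; exact: integ_cst. Qed.

Lemma L2_integ f : L2 f -> integ f.
Proof.
by move=> hf; apply: (eq_integ _ (L2M hf (L2_cst 1))) => w; rewrite mulr1.
Qed.

Lemma L2_lin a b f g : L2 f -> L2 g -> L2 (fun w => a * f w + b * g w).
Proof.
move=> hf hg; split.
  by apply: measurable_funD; apply: measurable_funM => //; [case: hf|case: hg].
have h := integD (integZ (a ^+ 2) (L2M hf hf))
  (integD (integZ (2 * a * b) (L2M hf hg)) (integZ (b ^+ 2) (L2M hg hg))).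
by apply: (eq_integ _ h) => w; ring.
Qed.

Lemma ae_eq_Ex f g : measurable_fun setT f -> measurable_fun setT g ->
  {ae P, forall w, f w = g w} -> Ex f = Ex g.
Proof.
move=> mf mg fg; congr fine; apply: ae_eq_integral => //.
- exact/measurable_EFinP.
- exact/measurable_EFinP.
- by apply: filterS fg => w /= -> _.
Qed.

Lemma bounded_cst (c : R) : bounded_rv (fun _ : Omega => c).
Proof. by split=> //; exists `|c|. Qed.

Lemma boundedD f g : bounded_rv f -> bounded_rv g ->
  bounded_rv (fun w => f w + g w).
Proof.
move=> [mf [a fa]] [mg [b gb]]; split; first exact: measurable_funD.
by exists (a + b) => w; rewrite (le_trans (ler_normD _ _))// lerD.
Qed.

Lemma boundedM f g : bounded_rv f -> bounded_rv g ->
  bounded_rv (fun w => f w * g w).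
Proof.
move=> [mf [a fa]] [mg [b gb]]; split; first exact: measurable_funM.
by exists (a * b) => w; rewrite normrM ler_pM.
Qed.

Lemma bounded_cos f : measurable_fun setT f -> bounded_rv (fun w => cos (f w)).
Proof.
move=> mf; split; last by exists 1 => w; exact: cos_max.
exact: measurableT_comp (continuous_measurable_fun (@continuous_cos R)) mf.
Qed.

Lemma bounded_sin f : measurable_fun setT f -> bounded_rv (fun w => sin (f w)).
Proof.
move=> mf; split; last by exists 1 => w; exact: sin_max.
exact: measurableT_comp (continuous_measurable_fun (@continuous_sin R)) mf.
Qed.

Lemma bounded_indic (A : set Omega) : measurable A ->
  bounded_rv (\1_A : Omega -> R).
Proof.
move=> mA; split; first exact: measurable_indic.
by exists 1 => w; rewrite indicE; case: (w \in A); rewrite ?normr1 ?normr0.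
Qed.

Lemma bounded_lim (F : nat -> Omega -> R) f M :
  (forall k, measurable_fun setT (F k)) -> (forall k w, `|F k w| <= M) ->
  (forall w, F ^~ w @ \oo --> f w) -> bounded_rv f.
Proof.
move=> mF FM Ff; split.
  by apply: (@measurable_fun_cvg _ _ _ setT F) => // w _; exact: Ff.
exists M => w.
have c1 : `|F k w| @[k --> \oo] --> `|f w| by apply: cvg_norm; exact: Ff.
rewrite -(cvg_lim (@norm_hausdorff _ _) c1); apply: limr_le.
  by apply/cvg_ex; eexists; exact: c1.
exact: nearW.
Qed.

End Expectation.

(** * Polynomials converging to a step *)

Section StepPolynomial.
Context {R : realType}.
Implicit Types x s : R.

(** With 2 ^ N alone as outer exponent these polynomials converge on [0, 1] to
    the indicator of [0, 1/2), except at s = 1/2 where the limit is 1/e; the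
    extra factor N makes the limit there 0, so that the limit is an indicator
    everywhere. *)
Definition step_poly (N : nat) s : R := (1 - s ^+ N) ^+ (N * 2 ^ N).

Lemma step_poly_itv N s : 0 <= s <= 1 -> 0 <= step_poly N s <= 1.
Proof.
move=> /andP[s0 s1].
have h0 : 0 <= s ^+ N by rewrite exprn_ge0.
have h1 : s ^+ N <= 1 by rewrite exprn_ile1.
by rewrite exprn_ge0 ?exprn_ile1 ?subr_ge0// lerBlDr lerDl.
Qed.

Lemma bernoulli_ge (m : nat) x : 0 <= x <= 1 -> 1 - m%:R * x <= (1 - x) ^+ m.
Proof.
move=> /andP[x0 x1]; elim: m => [|m IH]; first by rewrite mul0r subr0 expr0.
have h : 0 <= (1 - x) ^+ m by rewrite exprn_ge0// subr_ge0.
have m0 : (0 : R) <= m%:R by rewrite ler0n.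
by rewrite exprS -natr1; nra.
Qed.

Lemma bernoulli_le (m : nat) x : 0 <= x <= 1 ->
  (1 - x) ^+ m <= (1 + m%:R * x)^-1.
Proof.
move=> /andP[x0 x1]; have m0 : (0 : R) <= m%:R by rewrite ler0n.
have p0 : 0 < 1 + m%:R * x by rewrite ltr_pwDl// mulr_ge0.
rewrite -[leRHS]mul1r ler_pdivlMr//.
elim: m m0 p0 => [|m IH] m0 p0; first by rewrite mul0r addr0 mulr1.
have n0 : (0 : R) <= m%:R by rewrite ler0n.
have q0 : 0 < 1 + m%:R * x by rewrite ltr_pwDl// mulr_ge0.
have {}IH := IH n0 q0.
have h : 0 <= (1 - x) ^+ m by rewrite exprn_ge0// subr_ge0.
have e : (1 - x) * (1 + m.+1%:R * x) <= 1 + m%:R * x by rewrite -natr1; nra.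
apply: le_trans IH; rewrite exprS mulrC mulrA [_ * (1 - x)]mulrC mulrC.
by rewrite ler_wpM2l.
Qed.

(** Writing s = t^2, Bernoulli's inequality bounds N t^N uniformly in N, and the
    other factor t^N tends to 0. *)
Lemma cvg_nat_mul_exp s : 0 <= s < 1 ->
  (fun N => N%:R * s ^+ N) @ \oo --> (0 : R).
Proof.
move=> /andP[s0 s1]; pose t := Num.sqrt s.
have t0 : 0 <= t by exact: sqrtr_ge0.
have t1 : t < 1 by rewrite -sqrtr1 ltr_sqrt.
have st : s = t * t by rewrite -expr2 sqr_sqrtr.
have p0 : 0 < 1 - t by rewrite subr_gt0.
have Nt N : N%:R * t ^+ N <= (1 - t)^-1.
  have N0 : (0 : R) <= N%:R by rewrite ler0n.
  have := @bernoulli_le N (1 - t); rewrite subKr => /(_ _) h.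
  have {}h : t ^+ N <= (1 + N%:R * (1 - t))^-1.
    by apply: h; apply/andP; split; lra.
  have q0 : 0 < 1 + N%:R * (1 - t) by nra.
  apply: (le_trans (ler_wpM2l N0 h)).
  by rewrite ler_pdivrMr// mulrC ler_pdivlMr//; lra.
apply: (@squeeze_cvgr _ _ _ _ (fun=> 0) (fun N => (1 - t)^-1 * t ^+ N)).
- apply: nearW => N; apply/andP; split; first by rewrite mulr_ge0// exprn_ge0.
  by rewrite st exprMn mulrA ler_wpM2r ?exprn_ge0.
- exact: cvg_cst.
- rewrite -[X in _ --> X](mulr0 (1 - t)^-1); apply: cvgM; first exact: cvg_cst.
  by apply: cvg_expr; rewrite ger0_norm.
Qed.

Lemma step_poly_lt s : 0 <= s < 2^-1 ->
  (fun N => step_poly N s) @ \oo --> (1 : R).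
Proof.
move=> /andP[s0 s1].
have s01 : 0 <= s <= 1 by apply/andP; split; lra.
apply: (@squeeze_cvgr _ _ _ _ (fun N => 1 - N%:R * (2 * s) ^+ N) (fun=> 1)).
- apply: nearW => N; have /andP[_ ->] := step_poly_itv N s01; rewrite andbT.
  have := @bernoulli_ge (N * 2 ^ N) (s ^+ N).
  rewrite natrM natrX exprMn mulrA; apply.
  by rewrite exprn_ge0// exprn_ile1//; case/andP: s01.
- rewrite -[X in _ --> X]subr0; apply: cvgB; first exact: cvg_cst.
  by apply: cvg_nat_mul_exp; apply/andP; split; lra.
- exact: cvg_cst.
Qed.

Lemma step_poly_ge s : 2^-1 <= s <= 1 ->
  (fun N => step_poly N s) @ \oo --> (0 : R).
Proof.
move=> /andP[s0 s1].
have s01 : 0 <= s <= 1 by apply/andP; split; lra.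
apply: (@squeeze_cvgr _ _ _ _ (fun=> 0) (fun N => N.+1%:R^-1)).
- apply: nearW => N; have /andP[-> _] := step_poly_itv N s01 => /=.
  apply: (@le_trans _ _ (1 + (N * 2 ^ N)%:R * s ^+ N)^-1).
    apply: bernoulli_le.
    by rewrite exprn_ge0 ?exprn_ile1//; case/andP: s01.
  have h : 1 <= (2 * s) ^+ N by apply: exprn_ege1; lra.
  have N0 : (0 : R) <= N%:R by rewrite ler0n.
  rewrite natrM natrX -mulrA -exprMn lef_pV2 ?posrE//; last by nra.
  by rewrite -natr1; nra.
- exact: cvg_cst.
- exact: cvg_harmonic.
Qed.

End StepPolynomial.

(** * Orthogonality to cosines implies orthogonality to events *)

Section TrigAnnihilator.
Context {R : realType} {d : measure_display} {Omega : measurableType d}.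
Variable P : probability Omega R.
Variable X : Omega -> R.
Hypothesis hX : integ P X.
Variable W : set (Omega -> R).
Hypothesis W0 : W (fun=> 0).
Hypothesis Wlin : forall a b f g, W f -> W g -> W (fun w => a * f w + b * g w).
Hypothesis Wmeas : forall f, W f -> measurable_fun setT f.
Hypothesis XW : forall f c, W f -> Ex P (fun w => X w * cos (f w + c)) = 0.
Implicit Types f g h : Omega -> R.

(** The signed measure with density X h has a vanishing Fourier transform on
    W. *)
Definition annihilated h : Prop := bounded_rv h /\
  forall f c, W f -> Ex P (fun w => X w * h w * cos (f w + c)) = 0.

(** Asking that multiplication by g preserve annihilation, and not only that g
    be annihilated, is what makes these functions stable under products. *)
Definition multiplier g : Prop := bounded_rv g /\
  forall h, annihilated h -> annihilated (fun w => h w * g w).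

Lemma bounded_cosW f c : W f -> bounded_rv (fun w => cos (f w + c)).
Proof. by move=> /Wmeas mf; apply: bounded_cos; exact: measurable_funD. Qed.

Let integ_term h f c : bounded_rv h -> W f ->
  integ P (fun w => X w * h w * cos (f w + c)).
Proof.
move=> bh Wf; apply: integM_bounded (bounded_cosW c Wf).
exact: integM_bounded.
Qed.

Lemma annihilatedD g h : annihilated g -> annihilated h ->
  annihilated (fun w => g w + h w).
Proof.
move=> [bg g0] [bh h0]; split; first exact: boundedD.
move=> f c Wf; rewrite -[RHS]addr0 -{1}(g0 f c Wf) -(h0 f c Wf) -ExD.
- by apply: eq_Ex => w; ring.
- exact: integ_term.
- exact: integ_term.
Qed.

Lemma annihilatedZ a h : annihilated h -> annihilated (fun w => h w * a).
Proof.
move=> [bh h0]; split; first exact: boundedM (bounded_cst a).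
move=> f c Wf; rewrite -[RHS](mulr0 a) -(h0 f c Wf) -ExZ;
  last exact: integ_term.
by apply: eq_Ex => w; ring.
Qed.

(** A product of two cosines is a half-sum of cosines of elements of W, up to
    phases. *)
Lemma annihilated_cos h f c : annihilated h -> W f ->
  annihilated (fun w => h w * cos (f w + c)).
Proof.
move=> [bh h0] Wf; split; first exact: boundedM bh (bounded_cosW c Wf).
move=> f' c' Wf'.
have Wp := Wlin 1 1 Wf' Wf; have Wm := Wlin 1 (-1) Wf' Wf.
have e : (fun w => X w * (h w * cos (f w + c)) * cos (f' w + c')) =1
    (fun w => 2^-1 * (X w * h w * cos (1 * f' w + 1 * f w + (c' + c))
             + X w * h w * cos (1 * f' w + -1 * f w + (c' - c)))).
  move=> w.
  have -> : 1 * f' w + 1 * f w + (c' + c) = (f' w + c') + (f w + c) by ring.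
  have -> : 1 * f' w + -1 * f w + (c' - c) = (f' w + c') - (f w + c) by ring.
  by move: (f' w + c') (f w + c) => u v; rewrite cosD cosB; field.
rewrite (eq_Ex P e) ExZ; last by apply: integD; exact: integ_term.
rewrite ExD; [|exact: integ_term..].
by rewrite (h0 _ _ Wp) (h0 _ _ Wm) addr0 mulr0.
Qed.

Lemma annihilated_lim (F : nat -> Omega -> R) h M :
  (forall k, annihilated (F k)) -> (forall k w, `|F k w| <= M) ->
  (forall w, F ^~ w @ \oo --> h w) -> annihilated h.
Proof.
move=> FA FM Fh.
have mF k : measurable_fun setT (F k) by case: (FA k) => -[].
have bh : bounded_rv h := bounded_lim mF FM Fh.
split => // f c Wf.
apply: (@Ex_limit_eq0 _ _ _ P (fun k w => X w * F k w * cos (f w + c)) _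
  (fun w => M * `|X w|)).
- move=> k; apply: integ_measurable; apply: integ_term => //; by case: (FA k).
- by apply: integ_measurable; exact: integ_term.
- exact/integZ/integ_norm.
- move=> k w; rewrite !normrM mulrC -[leRHS]mul1r; apply: ler_pM => //.
    exact: cos_max.
  by rewrite mulrC ler_wpM2r.
- move=> w; apply: cvgM; last exact: cvg_cst.
  by apply: cvgM; [exact: cvg_cst|exact: Fh].
- by move=> k; case: (FA k) => _; exact.
Qed.

Lemma eq_multiplier f g : f =1 g -> multiplier f -> multiplier g.
Proof. by move=> /funext ->. Qed.

Lemma multiplier_cst a : multiplier (fun=> a).
Proof. by split; [exact: bounded_cst|move=> h; exact: annihilatedZ]. Qed.

Lemma multiplierD f g : multiplier f -> multiplier g ->
  multiplier (fun w => f w + g w).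
Proof.
move=> [bf hf] [bg hg]; split; first exact: boundedD.
move=> h hh; have := annihilatedD (hf h hh) (hg h hh).
by under eq_fun do rewrite -mulrDr.
Qed.

Lemma multiplierM f g : multiplier f -> multiplier g ->
  multiplier (fun w => f w * g w).
Proof.
move=> [bf hf] [bg hg]; split; first exact: boundedM.
by move=> h /hf /hg; under eq_fun do rewrite -mulrA.
Qed.

Lemma multiplierX f n : multiplier f -> multiplier (fun w => f w ^+ n).
Proof.
move=> mf; elim: n => [|n IH]; first exact: multiplier_cst.
by under eq_fun do rewrite exprS; exact: multiplierM.
Qed.

Lemma multiplier_cos f c : W f -> multiplier (fun w => cos (f w + c)).
Proof.
by move=> Wf; split; [exact: bounded_cosW|move=> h hh; exact: annihilated_cos].
Qed.

Lemma multiplier_lim (F : nat -> Omega -> R) g M :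
  (forall k, multiplier (F k)) -> (forall k w, `|F k w| <= M) ->
  (forall w, F ^~ w @ \oo --> g w) -> multiplier g.
Proof.
move=> FA FM Fg.
have lim h : annihilated h -> annihilated (fun w => h w * g w).
  move=> hh; have [[mh [b hb]] _] := hh.
  apply: (@annihilated_lim (fun k w => h w * F k w) _ (b * M)).
  - by move=> k; case: (FA k) => _; exact.
  - by move=> k w; rewrite normrM ler_pM.
  - by move=> w; apply: cvgM (Fg w); exact: cvg_cst.
split => //; apply: (bounded_lim _ FM Fg).
by move=> k; case: (FA k) => -[].
Qed.

(** With s = (1 + sin (f + c)) / 2, a value in [0, 1], the step at s = 1/2 is
    the step at sin (f + c) = 0. *)
Lemma multiplier_step f c : W f ->
  multiplier (fun w => if sin (f w + c) < 0 then 1 else 0).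
Proof.
move=> Wf; pose s w := 2^-1 * (1 + sin (f w + c)).
have s01 w : 0 <= s w <= 1.
  by have := sin_geN1 (f w + c); have := sin_le1 (f w + c); rewrite /s; lra.
have ms : multiplier s.
  apply: multiplierM (multiplier_cst _) _.
  apply: multiplierD (multiplier_cst _) _.
  have := multiplier_cos (c - pi / 2) Wf.
  by under eq_fun do rewrite addrA cosBpihalf.
apply: (@multiplier_lim (fun N w => step_poly N (s w)) _ 1).
- move=> N; apply: multiplierX; apply: multiplierD (multiplier_cst _) _.
  have := multiplierM (multiplier_cst (-1)) (multiplierX N ms).
  by under eq_fun do rewrite mulN1r.
- move=> k w; have /andP[h0 h1] := step_poly_itv k (s01 w).
  by rewrite ger0_norm.
- move=> w; have := s01 w; case: ltP => h /andP[s0 s1].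
    by apply: step_poly_lt; rewrite s0 /s /=; lra.
  by apply: step_poly_ge; rewrite s1 /s andbT; lra.
Qed.

(** For k large, (f w - a) / (k + 1) lies in (-pi, pi), where the sine has the
    sign of its argument; so the periodic steps converge to a half-line. *)
Lemma multiplier_lt f a : W f ->
  multiplier (fun w => if f w < a then 1 else 0).
Proof.
move=> Wf.
pose F (k : nat) w : R :=
  if sin (k.+1%:R^-1 * f w + 0 * f w + - (k.+1%:R^-1 * a)) < 0 then 1 else 0.
apply: (@multiplier_lim F _ 1).
- by move=> k; apply: multiplier_step (Wlin _ _ Wf Wf).
- by move=> k w; rewrite /F; case: ifP; rewrite ?normr1 ?normr0.
- move=> w; apply: cvg_near_cst.
  near=> k; rewrite /F mul0r addr0 -mulrBr.
  set x := k.+1%:R^-1 * (f w - a).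
  have k0 : 0 < k.+1%:R^-1 :> R by rewrite invr_gt0.
  have hx : `|x| < pi.
    rewrite /x normrM (gtr0_norm k0) mulrC ltr_pdivrMr//.
    rewrite (@lt_le_trans _ _ (1 * k.+1%:R))//; last first.
      by rewrite ler_wpM2r//; have := @pi_ge2 R; lra.
    rewrite mul1r; near: k.
    have [n _ hn] := nbhs_infty_gtr `|f w - a|.
    by exists n => // m /hn/= h; rewrite (lt_trans h)// ltr_nat.
  have xs : (x < 0) = (f w < a) by rewrite /x pmulr_rlt0// subr_lt0.
  rewrite -xs; have [xn|xp] := ltP x 0.
    suff -> : sin x < 0 by [].
    rewrite -oppr_gt0 -sinN sin_gt0_pi//.
    by rewrite oppr_gt0 xn/=; move: hx; rewrite ltr0_norm.
  rewrite ltNge sin_ge0_pi// xp/=.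
  by rewrite ltW//; move: hx; rewrite ger0_norm.
Unshelve. all: by end_near. Qed.

Definition multiplier_set : set (set Omega) := [set A | multiplier (\1_A)].

(** Closure under products gives finite intersections, hence with complements
    finite unions; countable unions are bounded limits of those. *)
Lemma multiplier_sigma_algebra : sigma_algebra setT multiplier_set.
Proof.
have mC A : multiplier_set A -> multiplier_set (setT `\` A).
  rewrite /multiplier_set /= => mA.
  apply: eq_multiplier (multiplierD (multiplier_cst 1)
    (multiplierM (multiplier_cst (-1)) mA)) => w.
  by rewrite setTD !indicE in_setC; case: (_ \in A) => /=; ring.
have m0 : multiplier_set set0.
  rewrite /multiplier_set /= indic0; exact: multiplier_cst.
split => // A mA.
have mU n : multiplier_set (\big[setU/set0]_(i < n.+1) A i).
  elim: n.+1 => [|{}n IH]; first by rewrite big_ord0.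
  rewrite big_ord_recr/= -[X in multiplier_set X]setCK -setTD.
  apply: (mC); rewrite setCU /multiplier_set /= indicI -!setTD.
  by apply: multiplierM; exact: mC.
rewrite -bigcup_bigsetU_bigcup.
apply: (@multiplier_lim (fun n => \1_(\big[setU/set0]_(i < n.+1) A i)) _ 1).
- exact: mU.
- by move=> k w; rewrite indicE; case: (_ \in _); rewrite ?normr1 ?normr0.
- move=> w; apply: cvg_near_cst; rewrite indicE.
  have [h|h] := boolP (w \in \bigcup_n \big[setU/set0]_(i < n.+1) A i).
    have [n _ hn] := set_mem h.
    exists n => // m /= nm; rewrite indicE mem_set//.
    move: hn; rewrite -!bigcup_mkord => -[i /= ni hi]; exists i => //=.
    exact: leq_trans ni _.
  near=> k; rewrite indicE memNset// => hk; move/negP: h; apply.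
  by rewrite inE; exists k.
Unshelve. all: by end_near. Qed.

(** This is a uniqueness theorem for Fourier transforms: if E[X e^{if}] = 0 for
    all linear combinations f of the Y_i, then X integrates to 0 over the
    sigma-algebra that the Y_i generate. *)
Lemma trig_annihilates (I : Type) (Y : I -> Omega -> R) (A : set Omega) :
  (forall i, W (Y i)) -> sigma_of Y A -> Ex P (fun w => X w * \1_A w) = 0.
Proof.
move=> WY YA.
have one : annihilated (fun=> 1).
  split=> [|f c Wf]; first exact: bounded_cst.
  by rewrite -[RHS](XW c Wf); apply: eq_Ex => w; rewrite mulr1.
suff [_ /(_ _ one)[_ /(_ _ 0 W0)]] : multiplier_set A.
  move=> h; rewrite -[RHS]h; apply: eq_Ex => w.
  by rewrite addr0 cos0 mulr1 mul1r.
apply: YA; split; first exact: multiplier_sigma_algebra.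
move=> B [i _] [C mC <-]; rewrite setTI.
pose G := [set D : set R | multiplier_set (Y i @^-1` D)].
suff : G C by [].
have : (@RGenInftyO.G R).-sigma.-measurable C.
  by rewrite -RGenInftyO.measurableE.
apply.
have [m0 hC hU] := multiplier_sigma_algebra.
split; first split.
- by rewrite /G /= preimage_set0.
- by move=> D; rewrite /G /= => /hC; rewrite !setTD preimage_setC.
- by move=> D hD; rewrite /G /= preimage_bigcup; exact: hU.
move=> D [a ->]; rewrite /G /multiplier_set /=.
apply: eq_multiplier (multiplier_lt a (WY i)) => w; rewrite indicE.
have -> : (w \in Y i @^-1` `]-oo, a[) = (Y i w < a).
  by apply/idP/idP; rewrite inE/= in_itv.
by case: ifP.
Qed.

End TrigAnnihilator.

(** * Stein's identity for the normal law *)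

Section Stein.
Context {R : realType}.
Notation mu := (@lebesgue_measure R).

(** The integral over [m - n, m + n] is a difference of boundary values, which
    vanishes in the limit, and dominated convergence identifies the limit of
    the integrals. *)
Lemma integral_derivative_eq0 (F f : R -> R) (m : R) :
  (forall x : R, is_derive x 1 F (f x)) -> continuous f ->
  mu.-integrable setT (EFin \o f) ->
  (fun n : nat => F (m + n%:R)) @ \oo --> (0 : R) ->
  (fun n : nat => F (m - n%:R)) @ \oo --> (0 : R) ->
  (\int[mu]_x (f x)%:E = 0)%E.
Proof.
move=> dF cf hf Fp Fm.
have cF : continuous F.
  move=> x; apply: differentiable_continuous; apply/derivable1_diffP.
  by have [] := dF x.
pose I (n : nat) := `[m - n.+1%:R, m + n.+1%:R]%classic.
have mI n : measurable (I n) by exact: measurable_itv.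
have IE n : (\int[mu]_(x in I n) (f x)%:E =
    (F (m + n.+1%:R) - F (m - n.+1%:R))%:E)%E.
  rewrite EFinB; apply: continuous_FTC2.
  - by rewrite ltrD2l gtrN.
  - exact: continuous_subspaceT.
  - split.
    + by move=> x _; have [] := dF x.
    + by apply: cvg_at_right_filter; exact: cF.
    + by apply: cvg_at_left_filter; exact: cF.
  - by move=> x _; rewrite derive1E; have [] := dF x.
have mf : measurable_fun setT f by exact: continuous_measurable_fun.
have [||||| _ _ h] := @dominated_convergence _ _ _ mu setT measurableT
  (fun n => (EFin \o f) \_ (I n)) (EFin \o f) (abse \o (EFin \o f)).
- move=> n; apply/(measurable_restrictT _ (mI n)).
  by apply: measurable_funTS; exact/measurable_EFinP.
- exact/measurable_EFinP.
- apply/aeW => x _; apply: cvg_near_cst.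
  have [n0 _ hn] := nbhs_infty_gtr `|x - m|.
  exists n0 => // n /= nn; rewrite patchE mem_set// /I /= in_itv/=.
  have : `|x - m| < n.+1%:R by rewrite (lt_trans (hn n nn))// ltr_nat.
  by rewrite ltr_norml => /andP[h1 h2]; apply/andP; split; lra.
- exact: integrable_abse.
- apply/aeW => x n _; rewrite patchE; case: ifP => _ //=.
  by rewrite normr0 lee_fin.
have h2 : (fun n => \int[mu]_x ((EFin \o f) \_ (I n)) x)%E @ \oo --> 0%E.
  under eq_fun do rewrite -integral_mkcond IE.
  apply: cvg_EFin; first exact: nearW.
  rewrite -[X in _ --> X](subr0 (0 : R)).
  by apply: cvgB; [move: Fp|move: Fm]; rewrite -cvg_shiftS.
by have := cvg_unique _ h h2; apply.
Qed.

Variables (m s : R).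
Hypothesis s0 : s != 0.
Notation N := (normal_prob m s).

(** The normal density is a Radon-Nikodym derivative of the normal law. *)
Lemma normal_prob_density (f : R -> R) : N.-integrable setT (EFin \o f) ->
  (\int[N]_x (f x)%:E = \int[mu]_x (f x * normal_pdf m s x)%:E)%E.
Proof.
move=> hf; have dom := normal_prob_dominates m s.
have mf := measurable_int _ hf.
have mpdf : measurable_fun setT (EFin \o normal_pdf m s).
  by apply/measurable_EFinP; exact: measurable_normal_pdf.
rewrite -(Radon_Nikodym_change_of_variables dom)//=.
under [RHS]eq_integral do rewrite EFinM.
apply: ae_eq_integral => //.
- apply: emeasurable_funM => //; exact: (measurable_int mu).
- exact: emeasurable_funM.
- apply: ae_eqe_mul2l => /=.
  rewrite Radon_NikodymE//=.
  case: cid => /= h [h1 h2 h3].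
  apply: integral_ae_eq => //=.
  by move=> E _ mE; rewrite -h3.
Qed.

Lemma integrable_normal_density (f : R -> R) : N.-integrable setT (EFin \o f) ->
  mu.-integrable setT (EFin \o (fun x => f x * normal_pdf m s x)).
Proof.
move=> hf; apply/integrableP; split.
  apply/measurable_EFinP; apply: measurable_funM.
    by move: (measurable_int _ hf) => /measurable_EFinP.
  exact: measurable_normal_pdf.
have hn : N.-integrable setT (EFin \o (fun x => `|f x|)).
  exact: integrable_norm.
rewrite [ltLHS](_ : _ = (\int[N]_x (`|f x|)%:E)%E).
  by have /integrableP[_] := hf.
rewrite normal_prob_density//; apply: eq_integral => x _ /=.
by rewrite normrM (ger0_norm (normal_pdf_ge0 _ _ _)).
Qed.

Lemma is_derive_normal_pdf (x : R) :
  is_derive x 1 (normal_pdf m s) (- (x - m) / s ^+ 2 * normal_pdf m s x).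
Proof.
rewrite normal_pdfE// /normal_fun.
have d1 : is_derive x (1 : R) (fun y => - (y - m) ^+ 2 / (s ^+ 2 *+ 2))
    (- (x - m) / s ^+ 2).
  have -> : (fun y => - (y - m) ^+ 2 / (s ^+ 2 *+ 2)) =
      (- (s ^+ 2 *+ 2)^-1) \*: ((id - cst m) ^+ 2).
    apply/funext => y; rewrite !fctE/= -[_ *: _]/(_ * _); ring.
  apply: is_derive_eq; rewrite /GRing.scale/= !fctE; field.
  by rewrite s0.
have d2 := is_derive1_comp (is_derive_expR _) d1.
have -> : (fun y : R => normal_peak s * expR (- (y - m) ^+ 2 / (s ^+ 2 *+ 2))) =
    normal_peak s \*: (expR \o (fun y => - (y - m) ^+ 2 / (s ^+ 2 *+ 2))).
  by [].
by apply: is_derive_eq; rewrite /GRing.scale/=; ring.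
Qed.

(** Quadratic decay, from exp(u) >= 1 + u; it is enough to kill boundary terms of
    linear growth. *)
Lemma normal_pdf_decay x : normal_pdf m s x <=
  normal_peak s / (1 + `|x - m| ^+ 2 / (s ^+ 2 *+ 2)).
Proof.
rewrite normal_pdfE// ler_wpM2l ?normal_peak_ge0// /normal_fun.
rewrite real_normK ?num_real//.
set u := (x - m) ^+ 2 / (s ^+ 2 *+ 2).
have u0 : 0 <= u by rewrite divr_ge0 ?mulrn_wge0 ?sqr_ge0.
rewrite mulNr -/u expRN lef_pV2 ?posrE ?expR_gt0//; first exact: expR_ge1Dx.
by rewrite ltr_pwDl.
Qed.

(** Integrate the derivative of s^2 g times the density, which is
    s^2 g' - (x - m) g times the density. *)
Lemma normal_stein (g g' : R -> R) (a b : R) :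
  (forall x : R, is_derive x 1 g (g' x)) -> continuous g' ->
  (forall x, `|g x| <= a + b * `|x - m|) ->
  N.-integrable setT (EFin \o (fun x => (x - m) * g x)) ->
  N.-integrable setT (EFin \o g') ->
  \int[N]_x ((x - m) * g x) = s ^+ 2 * \int[N]_x (g' x).
Proof.
move=> dg cg' gb i1 i2.
have i3 : N.-integrable setT (EFin \o (fun x => s ^+ 2 * g' x)).
  exact: (integrableZl measurableT (s ^+ 2) i2).
have i4 : N.-integrable setT (EFin \o (fun x => s ^+ 2 * g' x - (x - m) * g x)).
  exact: (integrableB measurableT i3 i1).
rewrite -RintegralZl//; apply/eqP; rewrite eq_sym -subr_eq0 -RintegralB//.
apply/eqP; rewrite /Rintegral normal_prob_density//.
pose F x := s ^+ 2 * (g x * normal_pdf m s x).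
have tail (u : nat -> R) : (forall n, `|u n - m| = n%:R) ->
    (fun n => F (u n)) @ \oo --> (0 : R).
  move=> hu; rewrite -cvg_shiftS; apply: norm_cvg0.
  pose c := (s ^+ 2 *+ 2)^-1.
  have c0 : 0 < c by rewrite invr_gt0 mulrn_wgt0// exprn_even_gt0.
  (* |g| <= (|a| + |b|) n and the density is at most peak / (c n^2) at distance
     n from m; the product is O(1 / n). *)
  pose C := s ^+ 2 * ((`|a| + `|b|) * (normal_peak s / c)).
  apply: (@squeeze_cvgr _ _ _ _ (fun=> 0) (fun n => C * n.+1%:R^-1)).
  - apply: nearW => n; rewrite normr_ge0/= /F /C.
    rewrite (normrM (s ^+ 2)) (normrM (g _)).
    rewrite (ger0_norm (sqr_ge0 s)) -mulrA ler_wpM2l ?sqr_ge0//.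
    rewrite (ger0_norm (normal_pdf_ge0 _ _ _)).
    have n1 : (1 : R) <= n.+1%:R by rewrite ler1n.
    have hg : `|g (u n.+1)| <= (`|a| + `|b|) * n.+1%:R.
      rewrite (le_trans (gb _))// hu mulrDl lerD ?ler_wpM2r ?ler_norm//.
      by rewrite (le_trans (ler_norm a))// ler_peMr.
    apply: le_trans (ler_pM _ _ hg (normal_pdf_decay _)) _ => //.
      exact: normal_pdf_ge0.
    rewrite hu -/c -!mulrA ler_wpM2l ?addr_ge0//.
    rewrite [leLHS]mulrCA ler_wpM2l ?normal_peak_ge0//.
    have nc : 0 <= n.+1%:R * (n.+1%:R * c) by rewrite !mulr_ge0// ltW.
    rewrite ler_pdivrMr; last by rewrite ltr_pwDl.
    have k0 : 0 < n.+1%:R :> R by rewrite ltr0n.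
    rewrite mulrDr mulr1.
    have -> : c^-1 / n.+1%:R * (n.+1%:R * (n.+1%:R * c)) = n.+1%:R :> R.
      by field; rewrite nat1r !gt_eqF.
    rewrite lerDr; apply: divr_ge0; last exact: ltW.
    by rewrite invr_ge0; exact: ltW.
  - exact: cvg_cst.
  - rewrite -[X in _ --> X](mulr0 C); apply: cvgM; first exact: cvg_cst.
    exact: cvg_harmonic.
rewrite -[RHS]/(fine 0%E); congr fine; apply: (@integral_derivative_eq0 F _ m).
- move=> x; have dp := is_derive_normal_pdf x; have dgx := dg x.
  have -> : F = s ^+ 2 \*: (g * normal_pdf m s) by [].
  by apply: is_derive_eq; rewrite /GRing.scale/=; field.
- have cg : continuous g.
    move=> x; apply: differentiable_continuous; apply/derivable1_diffP.
    by have [] := dg x.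
  move=> x; apply: cvgM; last exact: continuous_normal_pdf.
  apply: cvgB; first by apply: cvgM; [exact: cvg_cst|exact: cg'].
  apply: cvgM; last exact: cg.
  by apply: cvgB; [exact: cvg_id|exact: cvg_cst].
- exact: integrable_normal_density.
- by apply: tail => n; rewrite addrAC subrr add0r normr_nat.
- by apply: tail => n; rewrite addrAC subrr add0r normrN normr_nat.
Qed.

End Stein.

(** * Centered Gaussian variables and Gaussian spaces *)

Section GaussianLaw.
Context {R : realType} {d : measure_display} {Omega : measurableType d}.
Variable P : probability Omega R.
Implicit Types (S X : Omega -> R) (f g : R -> R).

Lemma law_integral (Q : probability (measurableTypeR R) R) S f :
  measurable_fun setT S -> measurable_fun setT f ->
  (forall A : set R, measurable A -> P (S @^-1` A) = Q A) ->
  integ P (f \o S) ->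
  integ Q f /\ Ex P (f \o S) = Ex Q f.
Proof.
move=> mS mf law ifS.
pose S' : {mfun Omega >-> measurableTypeR R} :=
  @mfun_Sub _ _ Omega (measurableTypeR R) S (mem_set mS).
have E (g : measurableTypeR R -> \bar R) :
    (\int[Q]_x g x = \int[distribution P S']_x g x)%E.
  by apply: eq_measure_integral => A mA _; exact/esym/law.
have mF : measurable_fun setT (EFin \o f) by exact/measurable_EFinP.
have ip : (distribution P S').-integrable setT (EFin \o f).
  by apply: (@integrable_pushforward _ _ _ _ _ S').
split.
  apply/integrableP; split => //; rewrite E.
  by have /integrableP[_] := ip.
rewrite /Ex /Rintegral E; congr fine; symmetry.
exact: (@integral_distribution _ _ _ _ _ P S' (EFin \o f)).
Qed.

Definition centered_gaussian S : Prop :=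
  [/\ is_gaussian P S, L2 P S & Ex P S = 0].

Lemma gaussian_stein (m s : R) S f f' a b : s != 0 -> measurable_fun setT S ->
  (forall A : set R, measurable A -> P (S @^-1` A) = normal_prob m s A) ->
  (forall x : R, is_derive x 1 f (f' x)) -> continuous f' ->
  (forall x, `|f x| <= a + b * `|x - m|) ->
  integ P (fun w => (S w - m) * f (S w)) -> integ P (fun w => f' (S w)) ->
  Ex P (fun w => (S w - m) * f (S w)) = s ^+ 2 * Ex P (fun w => f' (S w)).
Proof.
move=> s0 mS law df cf' fb i1 i2.
have mf : measurable_fun setT f.
  apply: continuous_measurable_fun => x.
  apply: differentiable_continuous; apply/derivable1_diffP.
  by have [] := df x.
have mfm : measurable_fun setT (fun x : R => (x - m) * f x).
  by apply: measurable_funM => //; exact: measurable_funB.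
have [j1 ->] := law_integral mS mfm law i1.
have [j2 ->] := law_integral mS (continuous_measurable_fun cf') law i2.
exact: normal_stein fb j1 j2.
Qed.

(** Stein's identity for the constant 1 and for the identity function shows that
    the parameters m and s^2 are the mean and the variance; the Dirac law is the
    first alternative. *)
Lemma centered_gaussian_law S : centered_gaussian S ->
  {ae P, forall w, S w = 0} /\ Ex P (fun w => S w ^+ 2) = 0 \/
  exists s, [/\ s != 0, Ex P (fun w => S w ^+ 2) = s ^+ 2 &
    forall A : set R, measurable A -> P (S @^-1` A) = normal_prob 0 s A].
Proof.
move=> [[mS [m [s law]]] S2 ES]; have iS := L2_integ S2.
have iS2 : integ P (fun w => S w ^+ 2) by case: S2.
move: law; have [_ law|s0 law] := eqVneq s 0.
  left; have m0 : m = 0.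
    rewrite -ES -[LHS](Ex_cst P); apply: ae_eq_Ex => //.
    by apply: filterS law => w ->.
  subst m; split => //.
  rewrite -[RHS](Ex_cst P); apply: ae_eq_Ex => //.
    exact: integ_measurable iS2.
  by apply: filterS law => w ->; rewrite expr0n.
right.
have m0 : m = 0.
  have := @gaussian_stein m s S (fun=> 1) (fun=> 0) 1 0 s0 mS law.
  rewrite (_ : Ex P (fun _ => 0) = 0) ?Ex_cst// mulr0.
  rewrite (@eq_Ex _ _ _ P (fun w => (S w - m) * 1) (fun w => S w - m));
    last by move=> w; rewrite mulr1.
  rewrite ExB ?Ex_cst//; last exact: integ_cst.
  rewrite ES sub0r => h; apply/eqP; rewrite -oppr_eq0; apply/eqP; apply: h.
  - by move=> x; exact: cvg_cst.
  - by move=> x; rewrite normr1 mul0r addr0.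
  - by apply: (eq_integ _ (integB iS (integ_cst P m))) => w; rewrite mulr1.
  - exact: integ_cst.
subst m; exists s; split => //.
have := @gaussian_stein 0 s S id (fun=> 1) 0 1 s0 mS law.
rewrite Ex_cst mulr1.
rewrite (@eq_Ex _ _ _ P _ (fun w => S w ^+ 2)); last first.
  by move=> w; rewrite subr0 expr2.
apply.

- by move=> x; exact: cvg_cst.
- by move=> x; rewrite add0r mul1r subr0.
- by apply: (eq_integ _ iS2) => w; rewrite subr0 expr2.
- exact: integ_cst.
Qed.

Lemma normal_prob_sqr (s t : R) : s != 0 -> t != 0 -> s ^+ 2 = t ^+ 2 ->
  normal_prob 0 s = normal_prob 0 t.
Proof.
move=> s0 t0 st; apply/funext => A; rewrite /normal_prob.
by rewrite !normal_pdfE// /normal_peak /normal_fun st.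
Qed.

(** The law of a centered Gaussian variable is determined by its variance. *)
Lemma centered_gaussian_eq_law S X f :
  centered_gaussian S -> centered_gaussian X ->
  Ex P (fun w => S w ^+ 2) = Ex P (fun w => X w ^+ 2) ->
  measurable_fun setT f -> (exists c, forall x, `|f x| <= c) ->
  Ex P (f \o S) = Ex P (f \o X).
Proof.
move=> gS gX SX mf [c fc].
have [[mS _] _ _] := gS; have [[mX _] _ _] := gX.
have mfS : measurable_fun setT (f \o S) by exact: measurableT_comp.
have mfX : measurable_fun setT (f \o X) by exact: measurableT_comp.
have iS : integ P (f \o S).
  by apply: bounded_integ; split=> //; exists c => w; exact: fc.
have iX : integ P (f \o X).
  by apply: bounded_integ; split=> //; exists c => w; exact: fc.
case: (centered_gaussian_law gS) => [[aS vS]|[s [s0 vs ls]]];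
case: (centered_gaussian_law gX) => [[aX vX]|[t [t0 vt lt]]].
- apply: ae_eq_Ex => //; near=> w; rewrite /=.
  by rewrite (near aS w)// (near aX w).
- by move: t0; rewrite -sqrf_eq0 -vt -SX vS eqxx.
- by move: s0; rewrite -sqrf_eq0 -vs SX vX eqxx.
- have [_ ->] := law_integral mS mf ls iS.
  have st : normal_prob 0 t = normal_prob 0 s.
    by apply: normal_prob_sqr => //; rewrite -vs -vt.
  rewrite st in lt.
  by have [_ ->] := law_integral mX mf lt iX.
Unshelve. all: by end_near. Qed.

Lemma norm_sin_le (x : R) : `|sin x| <= `|x|.
Proof.
have pos (y : R) : 0 <= y -> `|sin y| <= y.
  rewrite le_eqVlt => /predU1P[<-|y0]; first by rewrite sin0 normr0.
  have [|c _] := @MVT R sin cos 0 y y0 (fun z _ => is_derive_sin z).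
    by apply: continuous_subspaceT; exact: continuous_sin.
  rewrite sin0 !subr0 => ->; rewrite normrM (gtr0_norm y0).
  by rewrite -[leRHS]mul1r ler_wpM2r ?cos_max// ltW.
have [x0|x0] := leP 0 x; first by rewrite (ger0_norm x0) pos.
rewrite (ltr0_norm x0).
by rewrite -normrN -sinN pos// oppr_ge0 ltW.
Qed.

Lemma cvg_sin_div (x : R) :
  (fun k : nat => k.+1%:R * sin (k.+1%:R^-1 * x)) @ \oo --> x.
Proof.
have hd : is_derive (0 : R) (1 : R) (fun t => sin (t * x)) x.
  have h : is_derive (0 : R) 1 (fun t => t * x) x.
    have -> : (fun t => t * x) = x \*: id.
      by apply/funext => t; rewrite mulrC.
    by apply: is_derive_eq; rewrite -[LHS]/(x * 1) mulr1.
  have := is_derive1_comp (is_derive_sin _) h.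
  by rewrite mul0r cos0 mul1r.
have dc : (fun h => h^-1 *: (((fun t => sin (t * x)) \o shift 0) (h *: 1)
    - sin (0 * x))) @ (0 : R)^' --> x.
  by rewrite -[X in _ --> X](derive_val (is_derive := hd)); have [] := hd.
have kc : (fun k : nat => k.+1%:R^-1 : R) @ \oo --> (0 : R)^'.
  move=> A [e /= e0 hA]; have := @cvg_harmonic R.
  move=> /cvgrPdist_lt /(_ e e0) [n _ hn]; exists n => // k /hn /=.
  rewrite sub0r normrN => hk; apply: hA; last by rewrite invr_neq0.
  by rewrite /ball_ /= sub0r normrN.
have := cvg_comp _ _ kc dc; apply: cvg_trans; apply: near_eq_cvg.
apply: nearW => k /=; rewrite mul0r sin0 subr0 invrK addr0.
by rewrite -[k.+1%:R^-1 *: _]/(_ * _) mulr1.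
Qed.

(** (k + 1) sin (X / (k + 1)) tends to X and is dominated by |X|; this trades an
    unbounded X for bounded sines. *)
Lemma Ex_small_angle X h : integ P X -> bounded_rv h ->
  (forall a : R, Ex P (fun w => sin (a * X w) * h w) = 0) ->
  Ex P (fun w => X w * h w) = 0.
Proof.
move=> iX bh E0; have mX := integ_measurable iX; have [mh [c hc]] := bh.
have mk (k : nat) : bounded_rv (fun w => sin (k.+1%:R^-1 * X w)).
  by apply: bounded_sin; exact: measurable_funM.
apply: (@Ex_limit_eq0 _ _ _ P
  (fun k w => k.+1%:R * (sin (k.+1%:R^-1 * X w) * h w)) _
  (fun w => c * `|X w|)).
- by move=> k; apply: measurable_funM => //; case: (boundedM (mk k) bh).
- exact: measurable_funM.
- exact/integZ/integ_norm.
- move=> k w; have k0 : 0 < k.+1%:R :> R by rewrite ltr0n.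
  rewrite !normrM mulrA mulrC ler_pM// (gtr0_norm k0).
  rewrite (le_trans (ler_wpM2l (ltW k0) (norm_sin_le _)))//.
  by rewrite normrM gtr0_norm ?invr_gt0// mulrA divff ?mul1r ?gt_eqF.
- move=> w; under eq_fun do rewrite mulrA.
  by apply: cvgM; [exact: cvg_sin_div|exact: cvg_cst].
- move=> k; rewrite ExZ ?E0 ?mulr0//.
  by apply: bounded_integ; exact: boundedM.
Qed.

End GaussianLaw.

Section GaussianSpace.
Context {R : realType} {d : measure_display} {Omega : measurableType d}.
Variable P : probability Omega R.
Implicit Types f g X S T : Omega -> R.

Definition gaussian_space (G : set (Omega -> R)) : Prop :=
  (forall a b f g, G f -> G g -> G (fun w => a * f w + b * g w)) /\
  (forall f, G f -> centered_gaussian P f).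

Variable G : set (Omega -> R).
Hypothesis hG : gaussian_space G.

Let Glin a b f g : G f -> G g -> G (fun w => a * f w + b * g w).
Proof. by case: hG => h _; exact: h. Qed.

Let Gcg f : G f -> centered_gaussian P f.
Proof. by case: hG => _ h; exact: h. Qed.

Let GL2 f : G f -> L2 P f. Proof. by move=> /Gcg[]. Qed.

Let Gmeas f : G f -> measurable_fun setT f. Proof. by move=> /GL2[]. Qed.

Let Gcos f : G f -> integ P (fun w => cos (f w)).
Proof. by move=> /Gmeas mf; apply/bounded_integ/bounded_cos. Qed.

Let Gsin f : G f -> integ P (fun w => sin (f w)).
Proof. by move=> /Gmeas mf; apply/bounded_integ/bounded_sin. Qed.

Lemma gaussian_sin_eq0 T : G T -> Ex P (fun w => sin (T w)) = 0.
Proof.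
move=> GT; have GN := Glin (-1) 0 GT GT.
have e : Ex P (@sin R \o T) = Ex P (@sin R \o (fun w => -1 * T w + 0 * T w)).
  apply: centered_gaussian_eq_law (Gcg GT) (Gcg GN) _ _ _.
  - by apply: eq_Ex => w; ring.
  - exact: continuous_measurable_fun (@continuous_sin R).
  - by exists 1 => x; exact: sin_max.
have e2 : Ex P (@sin R \o (fun w => -1 * T w + 0 * T w)) =
    -1 * Ex P (fun w => sin (T w)).
  rewrite -ExZ; last exact: Gsin.
  by apply: eq_Ex => w /=; rewrite mul0r addr0 !mulN1r sinN.
move: e; rewrite e2 /comp => h; lra.
Qed.

(** sin (a X) cos S is a half-sum of sines of the Gaussian variables a X + S and
    a X - S, which have expectation 0 by symmetry. *)
Lemma gaussian_cos_eq0 X S : G X -> G S -> Ex P (fun w => X w * cos (S w)) = 0.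
Proof.
move=> GX GS; apply: Ex_small_angle.
- exact/L2_integ/GL2.
- exact/bounded_cos/Gmeas.
move=> a; have Gp := Glin a 1 GX GS; have Gm := Glin a (-1) GX GS.
rewrite (@eq_Ex _ _ _ P _ (fun w => 2^-1 *
  (sin (a * X w + 1 * S w) + sin (a * X w + -1 * S w)))); last first.
  by move=> w; rewrite mul1r mulN1r; move: (a * _) (S w) => x y;
    rewrite sinD sinB; field.
rewrite ExZ; last by apply: integD; exact: Gsin.
by rewrite ExD ?gaussian_sin_eq0 ?addr0 ?mulr0//; exact: Gsin.
Qed.

(** 2 sin (a X) sin S is the difference of the cosines of a X - S and a X + S,
    which have the same law because X and S are uncorrelated. *)
Lemma gaussian_uncorrelated_sin X S : G X -> G S ->
  Ex P (fun w => X w * S w) = 0 -> Ex P (fun w => X w * sin (S w)) = 0.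
Proof.
move=> GX GS XS; apply: Ex_small_angle.
- exact/L2_integ/GL2.
- exact/bounded_sin/Gmeas.
move=> a; have Gp := Glin a 1 GX GS; have Gm := Glin a (-1) GX GS.
rewrite (@eq_Ex _ _ _ P _ (fun w => 2^-1 *
  (cos (a * X w + -1 * S w) - cos (a * X w + 1 * S w)))); last first.
  by move=> w; rewrite mul1r mulN1r; move: (a * _) (S w) => x y;
    rewrite cosB cosD; field.
rewrite ExZ; last by apply: integB; exact: Gcos.
rewrite ExB; [|exact: Gcos..].
have iXX := L2M (GL2 GX) (GL2 GX); have iXS := L2M (GL2 GX) (GL2 GS).
have iSS := L2M (GL2 GS) (GL2 GS).
have var b : Ex P (fun w => (a * X w + b * S w) ^+ 2) =
    a ^+ 2 * Ex P (fun w => X w * X w) + b ^+ 2 * Ex P (fun w => S w * S w).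
  rewrite (@eq_Ex _ _ _ P _ (fun w => (a ^+ 2 * (X w * X w) +
    b ^+ 2 * (S w * S w)) + (2 * a * b) * (X w * S w))); last by move=> w; ring.
  rewrite ExD; [|by apply: integD; exact: integZ|exact: integZ].
  by rewrite ExD ?ExZ// ?XS ?mulr0 ?addr0//; exact: integZ.
have e : Ex P (@cos R \o (fun w => a * X w + -1 * S w)) =
    Ex P (@cos R \o (fun w => a * X w + 1 * S w)).
  apply: centered_gaussian_eq_law (Gcg Gm) (Gcg Gp) _ _ _.
  - by rewrite !var; ring.
  - exact: continuous_measurable_fun (@continuous_cos R).
  - by exists 1 => x; exact: cos_max.
by move: e; rewrite /comp => ->; rewrite subrr mulr0.
Qed.

Lemma gaussian_self_sin S : G S -> Ex P (fun w => S w * sin (S w)) =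
  Ex P (fun w => S w ^+ 2) * Ex P (fun w => cos (S w)).
Proof.
move=> GS; have mS := Gmeas GS; have iS := L2_integ (GL2 GS).
have iSs : integ P (fun w => S w * sin (S w)).
  by apply: integM_bounded => //; exact: bounded_sin.
case: (centered_gaussian_law (Gcg GS)) => [[aS ->]|[s [s0 -> ls]]].
  rewrite mul0r -[RHS](Ex_cst P); apply: ae_eq_Ex => //.
    exact: integ_measurable iSs.
  by apply: filterS aS => w ->; rewrite mul0r.
have := @gaussian_stein _ _ _ P 0 s S sin cos 1 0 s0 mS ls.
rewrite (@eq_Ex _ _ _ P _ (fun w => S w * sin (S w))); last first.
  by move=> w; rewrite subr0.
apply.
- exact: continuous_cos.
- by move=> x; rewrite mul0r addr0 sin_max.
- by apply: eq_integ iSs => w; rewrite subr0.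
- exact: Gcos.
Qed.

(** Split X into its regression on S, to which Stein's identity applies, and a
    residual uncorrelated with S. *)
Lemma gaussian_sin X S : G X -> G S -> Ex P (fun w => X w * sin (S w)) =
  Ex P (fun w => X w * S w) * Ex P (fun w => cos (S w)).
Proof.
move=> GX GS; have mS := Gmeas GS; have iX := L2_integ (GL2 GX).
have iS := L2_integ (GL2 GS).
have bs := bounded_sin mS.
have iXS := L2M (GL2 GX) (GL2 GS).
pose v := Ex P (fun w => S w ^+ 2).
have [v0|v0] := eqVneq v 0.
  case: (centered_gaussian_law (Gcg GS)) => [[aS _]|[s [s0 vs _]]]; last first.
    by move: s0; rewrite -sqrf_eq0 -vs -/v v0 eqxx.
  have -> : Ex P (fun w => X w * S w) = 0.
    rewrite -[RHS](Ex_cst P); apply: ae_eq_Ex => //.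
      exact: integ_measurable iXS.
    by apply: filterS aS => w ->; rewrite mulr0.
  rewrite mul0r -[RHS](Ex_cst P); apply: ae_eq_Ex => //.
    by apply: integ_measurable; exact: integM_bounded iX bs.
  by apply: filterS aS => w ->; rewrite sin0 mulr0.
(* The regression coefficient of X on S. *)
pose c := Ex P (fun w => X w * S w) / v.
have Gr := Glin 1 (- c) GX GS.
have r0 : Ex P (fun w => (1 * X w + - c * S w) * S w) = 0.
  rewrite (@eq_Ex _ _ _ P _ (fun w => X w * S w - c * S w ^+ 2)); last first.
    by move=> w; ring.
  have iS2 : integ P (fun w => S w ^+ 2) by case: (GL2 GS).
  rewrite ExB//; last exact: integZ.
  by rewrite ExZ// -/v /c divfK// subrr.
have := gaussian_uncorrelated_sin Gr GS r0.
rewrite (@eq_Ex _ _ _ P _ (fun w =>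
  X w * sin (S w) - c * (S w * sin (S w)))); last by move=> w; ring.
rewrite ExB; [|exact: integM_bounded|by apply: integZ; exact: integM_bounded].
rewrite ExZ; last exact: integM_bounded.
move=> /subr0_eq ->.
by rewrite gaussian_self_sin// -/v mulrA /c divfK.
Qed.

Lemma gaussian_cos_phase X S c : G X -> G S ->
  Ex P (fun w => X w * cos (S w + c)) =
  - sin c * Ex P (fun w => X w * S w) * Ex P (fun w => cos (S w)).
Proof.
move=> GX GS; have mS := Gmeas GS; have iX := L2_integ (GL2 GX).
have ic : integ P (fun w => X w * cos (S w)).
  by apply: integM_bounded => //; exact: bounded_cos.
have is' : integ P (fun w => X w * sin (S w)).
  by apply: integM_bounded => //; exact: bounded_sin.
rewrite (@eq_Ex _ _ _ P _ (fun w => cos c * (X w * cos (S w)) -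
  sin c * (X w * sin (S w)))); last by move=> w; rewrite cosD; ring.
rewrite ExB; [|exact: integZ..].
rewrite !ExZ// gaussian_cos_eq0// gaussian_sin//.
by rewrite mulr0 sub0r !mulNr mulrA.
Qed.

End GaussianSpace.

(** * Independent Gaussian spaces *)

Section Independence.
Context {R : realType} {d : measure_display} {Omega : measurableType d}.
Variable P : probability Omega R.
Implicit Types f g X S T : Omega -> R.

Definition sigma_measurable (A : set (set Omega)) f : Prop :=
  forall D : set R, measurable D -> A (f @^-1` D).

Lemma sigma_measurable_comp A f (h : R -> R) : measurable_fun setT h ->
  sigma_measurable A f -> sigma_measurable A (h \o f).
Proof.
move=> mh Af D mD; rewrite comp_preimage; apply: Af.
by rewrite -[_ @^-1` _]setTI; exact: mh.
Qed.

Lemma sigma_measurableP A f : sigma_algebra setT A ->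
  sigma_measurable A f <-> measurable_fun setT (f : g_sigma_algebraType A -> R).
Proof.
move=> sA; split=> [h _ D mD|h D mD].
  by rewrite setTI; apply: sub_sigma_algebra; exact: h.
by have := h measurableT D mD; rewrite setTI /measurable/= sigma_algebra_id.
Qed.

Lemma sigma_measurableM A f g : sigma_algebra setT A ->
  sigma_measurable A f -> sigma_measurable A g ->
  sigma_measurable A (fun w => f w * g w).
Proof.
move=> sA /(sigma_measurableP _ sA) mf /(sigma_measurableP _ sA) mg.
by apply/(sigma_measurableP _ sA); exact: measurable_funM.
Qed.

Lemma independent_sigmaC A B :
  independent_sigma P A B -> independent_sigma P B A.
Proof. by move=> AB E F BE AF; rewrite setIC AB// muleC. Qed.

(** Independence makes the law of (f, g) a product measure; then Fubini. *)
Lemma indep_Ex A B f g : independent_sigma P A B ->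
  sigma_measurable A f -> sigma_measurable B g ->
  integ P f -> integ P g -> integ P (fun w => f w * g w) ->
  Ex P (fun w => f w * g w) = Ex P f * Ex P g.
Proof.
move=> AB Af Bg hf hg hfg.
have mf := integ_measurable hf; have mg := integ_measurable hg.
pose f' : {mfun Omega >-> R} := mfun_Sub (mem_set mf).
pose g' : {mfun Omega >-> R} := mfun_Sub (mem_set mg).
have mh : measurable_fun setT (fun w => (f w, g w)).
  exact: measurable_fun_pair.
pose h' : {mfun Omega >-> (R * R)%type} := mfun_Sub (mem_set mh).
pose F (x : R * R) : \bar R := (x.1 * x.2)%:E.
have mF : measurable_fun setT F.
  by apply/measurable_EFinP; apply: measurable_funM.
have Eh : forall C, measurable C ->
    (distribution P f' \x distribution P g')%E C = distribution P h' C.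
  apply: product_measure_unique => D1 D2 mD1 mD2.
  exact: AB (Af _ mD1) (Bg _ mD2).
have ih : (distribution P h').-integrable setT F.
  by apply: (@integrable_pushforward _ _ _ _ _ h').
have ip : (distribution P f' \x distribution P g')%E.-integrable setT F.
  apply/integrableP; split => //.
  rewrite (eq_measure_integral (distribution P h'));
    last by move=> C mC _; exact: Eh.
  by have /integrableP[_] := ih.
have if' : (distribution P f').-integrable setT (EFin \o id).
  apply: (@integrable_pushforward _ _ _ _ _ f') => //.
  exact/measurable_EFinP.
have ig' : (distribution P g').-integrable setT (EFin \o id).
  apply: (@integrable_pushforward _ _ _ _ _ g') => //.
  exact/measurable_EFinP.
have e1 : (\int[distribution P h']_x F x = (Ex P (fun w => f w * g w))%:E)%E.
  rewrite integral_distribution//.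
  by rewrite EFin_Ex.
have e2 : (\int[distribution P f']_x (x)%:E = (Ex P f)%:E)%E.
  by rewrite (@integral_distribution _ _ _ _ _ P f' EFin)// EFin_Ex.
have e3 : (\int[distribution P g']_x (x)%:E = (Ex P g)%:E)%E.
  by rewrite (@integral_distribution _ _ _ _ _ P g' EFin)// EFin_Ex.
apply: EFin_inj; rewrite -e1 EFinM -e2.
rewrite -(eq_measure_integral (distribution P h') (fun C mC _ => Eh C mC)).
rewrite -integral12_prod_meas1//= -integralZr//=.
apply: eq_integral => x _; rewrite /F /fubini_F /=.
under eq_integral do rewrite EFinM.
by rewrite integralZl//= e3.
Qed.

Lemma indep_Ex_bounded A B f g : independent_sigma P A B ->
  sigma_measurable A f -> sigma_measurable B g ->
  integ P f -> bounded_rv g ->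
  Ex P (fun w => f w * g w) = Ex P f * Ex P g.
Proof.
move=> AB Af Bg hf bg; apply: (indep_Ex AB Af Bg hf).
  exact: bounded_integ.
exact: integM_bounded.
Qed.

Section Sum.
Variables (A B : set (set Omega)) (G1 G2 : set (Omega -> R)).
Hypothesis sA : sigma_algebra setT A.
Hypothesis sB : sigma_algebra setT B.
Hypothesis AB : independent_sigma P A B.
Hypothesis g1 : gaussian_space P G1.
Hypothesis g2 : gaussian_space P G2.
Hypothesis m1 : forall f, G1 f -> sigma_measurable A f.
Hypothesis m2 : forall f, G2 f -> sigma_measurable B f.

Let G1_L2 f : G1 f -> L2 P f. Proof. by case: g1 => _ h /h[]. Qed.
Let G2_L2 f : G2 f -> L2 P f. Proof. by case: g2 => _ h /h[]. Qed.

Lemma indep_gaussian_ExM X1 X2 : G1 X1 -> G2 X2 ->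
  Ex P (fun w => X1 w * X2 w) = 0.
Proof.
move=> GX1 GX2; have iX1 := L2_integ (G1_L2 GX1).
have iX2 := L2_integ (G2_L2 GX2).
rewrite (indep_Ex AB (m1 GX1) (m2 GX2) iX1 iX2 (L2M (G1_L2 GX1) (G2_L2 GX2))).
by case: g1 => _ /(_ _ GX1)[_ _ ->]; rewrite mul0r.
Qed.

(** By the addition formulas the left-hand side is a sum of products of
    expectations.  Those containing E[sin S] or E[sin T] vanish, and the two
    others add up to - sin c (E[X1 S] + E[X2 T]) E[cos S] E[cos T]. *)
Lemma indep_gaussian_cos X1 X2 S T (c : R) : G1 X1 -> G2 X2 -> G1 S -> G2 T ->
  Ex P (fun w => X1 w * S w) + Ex P (fun w => X2 w * T w) = 0 ->
  Ex P (fun w => (X1 w + X2 w) * cos (S w + T w + c)) = 0.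
Proof.
move=> GX1 GX2 GS GT XW.
have mS : measurable_fun setT S by case: (G1_L2 GS).
have mT : measurable_fun setT T by case: (G2_L2 GT).
have mSc : measurable_fun setT (fun w => S w + c) by exact: measurable_funD.
have mTc : measurable_fun setT (fun w => T w + c) by exact: measurable_funD.
have iX1 := L2_integ (G1_L2 GX1); have iX2 := L2_integ (G2_L2 GX2).
have sm1 (h : R -> R) f : continuous h -> G1 f -> sigma_measurable A (h \o f).
  move=> ch /m1; apply: sigma_measurable_comp; exact: continuous_measurable_fun.
have sm2 (h : R -> R) f : continuous h -> G2 f -> sigma_measurable B (h \o f).
  move=> ch /m2; apply: sigma_measurable_comp; exact: continuous_measurable_fun.
have cc := @continuous_cos R; have cs := @continuous_sin R.
have shift (h : R -> R) : continuous h -> continuous (fun x : R => h (x + c)).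
  move=> ch x; apply: continuous_comp; last exact: ch.
  by apply: cvgD; [exact: cvg_id|exact: cvg_cst].
have bcS := bounded_cos mS; have bsS := bounded_sin mS.
have bcT := bounded_cos mT; have bsT := bounded_sin mT.
have bcS' := bounded_cos mSc; have bsS' := bounded_sin mSc.
have bcT' := bounded_cos mTc; have bsT' := bounded_sin mTc.
have BA := independent_sigmaC AB.
pose f1 w := X1 w * cos (S w + c); pose f2 w := X1 w * sin (S w + c).
pose f3 w := X2 w * cos (T w + c); pose f4 w := X2 w * sin (T w + c).
have i1 : integ P f1 by exact: integM_bounded.
have i2 : integ P f2 by exact: integM_bounded.
have i3 : integ P f3 by exact: integM_bounded.
have i4 : integ P f4 by exact: integM_bounded.
have s1 : sigma_measurable A f1.
  by apply: sigma_measurableM (m1 GX1) (sm1 _ _ (shift _ cc) GS).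
have s2 : sigma_measurable A f2.
  by apply: sigma_measurableM (m1 GX1) (sm1 _ _ (shift _ cs) GS).
have s3 : sigma_measurable B f3.
  by apply: sigma_measurableM (m2 GX2) (sm2 _ _ (shift _ cc) GT).
have s4 : sigma_measurable B f4.
  by apply: sigma_measurableM (m2 GX2) (sm2 _ _ (shift _ cs) GT).
rewrite (@eq_Ex _ _ _ P _ (fun w =>
  (f1 w * cos (T w) - f2 w * sin (T w)) +
  (f3 w * cos (S w) - f4 w * sin (S w)))).
  rewrite ExD; [|by apply: integB; exact: integM_bounded..].
  rewrite !ExB; [|exact: integM_bounded..].
  rewrite (indep_Ex_bounded AB s1 (sm2 _ _ cc GT) i1 bcT).
  rewrite (indep_Ex_bounded AB s2 (sm2 _ _ cs GT) i2 bsT).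
  rewrite (indep_Ex_bounded BA s3 (sm1 _ _ cc GS) i3 bcS).
  rewrite (indep_Ex_bounded BA s4 (sm1 _ _ cs GS) i4 bsS).
  rewrite (gaussian_cos_phase g1 c GX1 GS) (gaussian_cos_phase g2 c GX2 GT).
  have sT0 : Ex P (@sin R \o T) = 0 := gaussian_sin_eq0 g2 GT.
  have sS0 : Ex P (@sin R \o S) = 0 := gaussian_sin_eq0 g1 GS.
  rewrite sT0 sS0 /comp !mulr0 !subr0.
  by move/eqP: XW; rewrite addrC addr_eq0 => /eqP ->; ring.
move=> w; rewrite /f1 /f2 /f3 /f4 mulrDl.
rewrite {1}(_ : S w + T w + c = (S w + c) + T w); last by ring.
rewrite (_ : S w + T w + c = (T w + c) + S w); last by ring.
by rewrite !(cosD (_ + c)); ring.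
Qed.

End Sum.
End Independence.

Section Span.
Context {R : realType} {d : measure_display} {Omega : measurableType d}.
Variable P : probability Omega R.
Context {I : eqType}.
Variable X : I -> Omega -> R.

(** A linear combination is a list of weighted indices, so that sums of
    combinations are concatenations. *)
Definition lin_span : set (Omega -> R) :=
  [set f | exists s : seq (R * I),
    f = fun w => \sum_(p <- s) p.1 * X p.2 w].

Lemma lin_span_gen i : lin_span (X i).
Proof.
by exists [:: (1, i)]; apply/funext => w; rewrite big_seq1 mul1r.
Qed.

Lemma lin_span_lin a b f g : lin_span f -> lin_span g ->
  lin_span (fun w => a * f w + b * g w).
Proof.
move=> [s ->] [t ->].
exists ([seq (a * p.1, p.2) | p <- s] ++ [seq (b * p.1, p.2) | p <- t]).
apply/funext => w; rewrite big_cat !big_map /= !big_distrr /=.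
by congr (_ + _); apply: eq_bigr => p _; rewrite mulrA.
Qed.

(** Joint Gaussianity speaks of one coefficient per index; this merges the
    repeated indices of a list. *)
Lemma lin_span_collect (s : seq (R * I)) w :
  \sum_(p <- s) p.1 * X p.2 w =
  \sum_(i <- undup (map snd s)) (\sum_(p <- s | p.2 == i) p.1) * X i w.
Proof.
under [RHS]eq_bigr do rewrite big_distrl /=.
rewrite (exchange_big_dep xpredT)//=.
rewrite big_seq [RHS]big_seq; apply: eq_bigr => p ps.
under [RHS]eq_bigl do rewrite eq_sym.
rewrite -big_filter filter_pred1_uniq ?undup_uniq ?big_seq1// mem_undup.
exact: map_f.
Qed.

Lemma lin_span_sigma_measurable f : lin_span f ->
  sigma_measurable (sigma_of X) f.
Proof.
move=> [s ->].
pose G := \bigcup_i preimage_set_system setT (X i) measurable.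
have mX i : measurable_fun setT (X i : g_sigma_algebraType G -> R).
  move=> _ D mD; rewrite setTI; apply: sub_sigma_algebra.
  by exists i => //; exists D => //; rewrite setTI.
have mf : measurable_fun setT
    ((fun w => \sum_(p <- s) p.1 * X p.2 w) : g_sigma_algebraType G -> R).
  by apply: measurable_sum => p; apply: measurable_funM.
move=> D mD; have := mf measurableT D mD; rewrite setTI; exact.
Qed.

Hypothesis jg : jointly_gaussian P X.
Hypothesis X_mean : forall i, ('E_P[X i] = 0)%E.
Hypothesis X_var : forall i, ('E_P[(fun w => X i w * X i w)%R] < +oo)%E.

Lemma lin_span_gaussian : gaussian_space P lin_span.
Proof.
have gX f : lin_span f -> is_gaussian P f.
  move=> [s ->].
  have := jg (undup (map snd s)) (fun i => \sum_(p <- s | p.2 == i) p.1).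
  congr is_gaussian; apply/funext => w; exact/esym/lin_span_collect.
have L2X i : L2 P (X i).
  have [mX _] := gX _ (lin_span_gen i).
  split => //; apply/integrableP; split.
    by apply/measurable_EFinP; exact: measurable_funX.
  move: (X_var i); rewrite unlock; apply: le_lt_trans.
  rewrite le_eqVlt; apply/orP; left; apply/eqP; apply: eq_integral => w _ /=.
  by rewrite ger0_norm ?sqr_ge0// expr2.
split=> [|f hf]; first exact: lin_span_lin.
have [s fE] := hf.
have L2f : L2 P f.
  rewrite fE {fE}; elim: s => [|p s IH].
    by under eq_fun do rewrite big_nil; exact: L2_cst.
  under eq_fun do rewrite big_cons -[X in _ + X]mul1r.
  exact: L2_lin (L2X p.2) IH.
split => //; first exact: gX.
rewrite fE Ex_sum; last by move=> p; apply: integZ; exact: L2_integ.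
rewrite big1// => p _; rewrite ExZ; last exact: L2_integ.
rewrite /Ex /Rintegral; move: (X_mean p.2); rewrite unlock => ->.
by rewrite mulr0.
Qed.

End Span.

(** * Positive definite matrices and the Woodbury identities *)

Section Posdef.
Context {R : realType}.

Lemma quad_ge0 m (A : 'M[R]_m) x : posdef A -> 0 <= quad A x.
Proof.
move=> [_ Apos]; have [->|/Apos/ltW//] := eqVneq x 0.
by rewrite /quad mulmx0 mxE.
Qed.

(** A nonzero vector of the kernel would make the quadratic form vanish. *)
Lemma posdef_unit m (A : 'M[R]_m) : posdef A -> A \in unitmx.
Proof.
move=> [_ Apos]; rewrite -row_free_unit -kermx_eq0.
apply: contraT => K0; pose v := nz_row (kermx A).
have v0 : v != 0 by rewrite nz_row_eq0.
have vA : v *m A = 0 by apply/sub_kermxP; exact: nz_row_sub.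
have := Apos v^T; rewrite trmx_eq0 => /(_ v0).
by rewrite /quad trmxK vA mul0mx mxE ltxx.
Qed.

Lemma quad_congr m p (A : 'M[R]_p) (B : 'M[R]_(m, p)) x :
  quad (B *m A *m B^T) x = quad A (B^T *m x).
Proof. by rewrite /quad trmx_mul trmxK !mulmxA. Qed.

Lemma posdef_congr m p (A : 'M[R]_p) (B : 'M[R]_(m, p)) :
  posdef A -> (forall x : 'cV_m, B^T *m x = 0 -> x = 0) ->
  posdef (B *m A *m B^T).
Proof.
move=> hA Binj; split; first by rewrite !trmx_mul trmxK hA.1 mulmxA.
move=> x x0; rewrite quad_congr; apply: hA.2.
by apply: contra x0 => /eqP /Binj ->.
Qed.

Lemma posdef_inv m (A : 'M[R]_m) : posdef A -> posdef (invmx A).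
Proof.
move=> hA; have uA := posdef_unit hA.
have sA : (invmx A)^T = invmx A by rewrite trmx_inv hA.1.
have -> : invmx A = invmx A *m A *m (invmx A)^T by rewrite sA mulVmx// mul1mx.
apply: posdef_congr => // x; rewrite sA => h.
by rewrite -[x]mul1mx -(mulmxV uA) -mulmxA h mulmx0.
Qed.

Lemma posdef_add_congr m p (A : 'M[R]_m) (C : 'M[R]_p) (B : 'M[R]_(m, p)) :
  posdef A -> posdef C -> posdef (B *m C *m B^T + A).
Proof.
move=> hA hC; split.
  by rewrite linearD /= !trmx_mul trmxK hA.1 hC.1 mulmxA.
move=> x x0; rewrite quadD quad_congr ltr_wpDl//; last exact: hA.2.
exact: quad_ge0.
Qed.

Lemma posdef_diag m p (A : 'M[R]_m) (C : 'M[R]_p) :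
  posdef A -> posdef C -> posdef (block_mx A 0 0 C).
Proof.
move=> hA hC; split; first by rewrite tr_block_mx hA.1 hC.1 !trmx0.
move=> x; rewrite -[x]vsubmxK quad_diag => x0.
have [u0|u0] := eqVneq (usubmx x) 0.
  have d0 : dsubmx x != 0.
    by apply: contra x0 => /eqP ->; rewrite u0 col_mx0.
  by rewrite ltr_wpDl ?quad_ge0//; exact: hC.2.
by rewrite ltr_pwDl ?quad_ge0//; exact: hA.2.
Qed.

End Posdef.

Section Woodbury.
Context {R : realType} {n q : nat}.
Variables (D : 'M[R]_n) (Rv : 'M[R]_q) (H : 'M[R]_(q, n)).
Hypotheses (hD : posdef D) (hR : posdef Rv).

Let Sg := H *m D *m H^T + Rv.
Let info := H^T *m invmx Rv *m H + invmx D.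

Lemma posdef_innovation : posdef Sg.
Proof. exact: posdef_add_congr. Qed.

Lemma posdef_info : posdef info.
Proof.
have := @posdef_add_congr _ _ _ (invmx D) (invmx Rv) H^T
  (posdef_inv hD) (posdef_inv hR).
by rewrite trmxK.
Qed.

Let uD := posdef_unit hD.
Let uR := posdef_unit hR.
Let uS := posdef_unit posdef_innovation.
Let uI := posdef_unit posdef_info.

(** Both sides agree after multiplication by the information matrix on the left
    and by the innovation covariance Sg on the right. *)
Lemma info_gain : invmx info *m H^T *m invmx Rv = D *m H^T *m invmx Sg.
Proof.
have h : info *m (D *m H^T) = H^T *m invmx Rv *m Sg.
  rewrite /info /Sg mulmxDl mulmxDr !mulmxA mulVmx// mul1mx.
  by rewrite mulmxKV.
have h2 : D *m H^T = invmx info *m (H^T *m invmx Rv *m Sg).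
  by rewrite -h mulKmx.
by rewrite h2 !mulmxA mulmxK.
Qed.

Lemma info_inv : invmx info = D - D *m H^T *m invmx Sg *m H *m D.
Proof.
have h : info *m (D - D *m H^T *m invmx Sg *m H *m D) = 1%:M.
  rewrite mulmxBr -info_gain !mulmxA mulmxV// mul1mx.
  by rewrite mulmxDl mulVmx// addrAC subrr add0r.
by rewrite -[LHS]mulmx1 -h mulKmx.
Qed.

Lemma info_prior : invmx info *m invmx D = 1%:M - D *m H^T *m invmx Sg *m H.
Proof. by rewrite info_inv mulmxBl mulmxV// mulmxK. Qed.

End Woodbury.

(** The penalty B^T P^-1 B contributes to B J^-1 (J + B^T P^-1 B) exactly as much
    as J does, because P = B J^-1 B^T; hence the factor 2.  Injectivity of B^T
    makes P invertible. *)
Lemma pdmm_half (R : realType) m p (J : 'M[R]_p) (B : 'M[R]_(m, p)) :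
  posdef J -> (forall x : 'cV_m, B^T *m x = 0 -> x = 0) ->
  2 *: (B *m invmx (J + B^T *m invmx (B *m invmx J *m B^T) *m B)) =
  B *m invmx J.
Proof.
move=> hJ Binj.
have hP := posdef_congr (posdef_inv hJ) Binj.
set P := B *m invmx J *m B^T in hP *.
have uJ := posdef_unit hJ; have uP := posdef_unit hP.
have hS := @posdef_add_congr _ _ _ J (invmx P) B^T hJ (posdef_inv hP).
rewrite trmxK addrC in hS; have uS := posdef_unit hS.
have h : B *m invmx J *m (J + B^T *m invmx P *m B) = 2 *: B.
  rewrite mulmxDr mulmxKV// !mulmxA -/P mulmxV// mul1mx.
  by rewrite scaler_nat mulr2n.
by rewrite scalemxAl -h mulmxK.
Qed.

(** * PDMM messages and the Riccati recursion *)

Section KalmanPDMM.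
Context {R : realType} {n r q : nat}.
Variable M : ssm R n r q.
Hypothesis hM : ssm_regular M.

(** The Kalman gain for the error covariance D. *)
Definition gain_of (D : 'M[R]_n) (i : nat) : 'M[R]_(n, q) :=
  ssF M i *m D *m (ssH M i)^T *m invmx (ssH M i *m D *m (ssH M i)^T + ssR M i).

Let GF i := row_mx (ssG M i) (ssF M i).

Let GF_inj i (x : 'cV_n) : (GF i)^T *m x = 0 -> x = 0.
Proof.
rewrite /GF tr_row_mx mul_col_mx -col_mx0 => /eq_col_mx[Gx Fx].
have /row_freeP[V FGV] := ssm_full_rank hM i.
apply: trmx_inj; rewrite trmx0 -[x^T]mulmx1 -FGV mulmxA mul_mx_row.
by rewrite -[ssF M i]trmxK -trmx_mul Fx -[ssG M i]trmxK -trmx_mul Gx !trmx0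
  row_mx0 mul0mx.
Qed.

Lemma posdef_infoJ D i : posdef D -> posdef (infoJ M D i).
Proof.
move=> hD; apply: posdef_diag.
  exact/posdef_inv/(ssm_Q_posdef hM).
exact: posdef_info hD (ssm_R_posdef hM i).
Qed.

Lemma edgePS i :
  edgeP M i.+1 = GF i *m invmx (infoJ M (edgeP M i) i) *m (GF i)^T.
Proof. by rewrite /GF tr_row_mx. Qed.

Lemma posdef_edgeP i : posdef (edgeP M i).
Proof.
elim: i => [|i IH]; first exact: ssm_Pi0_posdef hM.
rewrite edgePS; apply: posdef_congr (@GF_inj i).
exact/posdef_inv/posdef_infoJ.
Qed.

Lemma GF_info D i : posdef D -> GF i *m invmx (infoJ M D i) =
  row_mx (ssG M i *m ssQ M i)
    (ssF M i *m invmx ((ssH M i)^T *m invmx (ssR M i) *m ssH M i + invmx D)).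
Proof.
move=> hD; rewrite /infoJ invmx_block_diag; last exact/posdef_unit/posdef_infoJ.
by rewrite mul_row_block !mulmx0 addr0 add0r invmxK.
Qed.

Lemma edgeP_riccati i : let D := edgeP M i in let K := gain_of D i in
  edgeP M i.+1 = ssF M i *m D *m (ssF M i)^T + ssG M i *m ssQ M i *m (ssG M i)^T
    - K *m (ssH M i *m D *m (ssH M i)^T + ssR M i) *m K^T.
Proof.
move=> D K; have hD : posdef D := posdef_edgeP i.
have hS := posdef_innovation (ssH M i) hD (ssm_R_posdef hM i).
have symD : D^T = D by case: hD.
set Sg := ssH M i *m D *m (ssH M i)^T + ssR M i in hS *.
have symS : (invmx Sg)^T = invmx Sg by rewrite trmx_inv hS.1.
have KSK : K *m Sg *m K^T =
    ssF M i *m (D *m (ssH M i)^T *m invmx Sg *m ssH M i *m D) *m (ssF M i)^T.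
  rewrite /K /gain_of -/Sg !trmx_mul trmxK symS symD !mulmxA.
  by rewrite mulmxKV ?posdef_unit.
rewrite edgePS -/D GF_info// /GF tr_row_mx mul_row_col KSK.
rewrite (info_inv _ hD (ssm_R_posdef hM i)) -/Sg mulmxBr mulmxBl.
by rewrite addrCA addrA.
Qed.

(** One message of PDMM, with J in place of the local matrix plus the penalty of
    the incoming edge, is one step of the Kalman filter with prior mean m and
    prior covariance D. *)
Lemma pdmm_step D i (m : 'cV[R]_n) (yi : 'cV[R]_q) : posdef D ->
  let J := infoJ M D i in let K := gain_of D i in
  let A := row_mx (- ssG M i) (- ssF M i) in
  - (2 *: (A *m invmx (J + A^T *m invmx (GF i *m invmx J *m (GF i)^T) *m A)
    *m (col_mx 0 ((ssH M i)^T *m invmx (ssR M i) *m yi)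
        + col_mx 0 (invmx D *m m)))) =
  (ssF M i - K *m ssH M i) *m m + K *m yi.
Proof.
move=> hD J K A; have hR := ssm_R_posdef hM i.
have -> : A = - GF i by rewrite /A /GF opp_row_mx.
rewrite [(- GF i)^T]raddfN /= !mulNmx !mulmxN opprK scalerN opprK scalemxAl.
rewrite pdmm_half; [|exact: posdef_infoJ|exact: GF_inj].
rewrite GF_info// add_col_mx addr0 mul_row_col mulmx0 add0r mulmxDr.
rewrite !mulmxA -2!(mulmxA (ssF M i)) (info_gain _ hD hR).
rewrite -(mulmxA (ssF M i) (invmx _)) (info_prior _ hD hR).
rewrite [LHS]addrC; congr (_ + _); last by rewrite /K /gain_of !mulmxA.
by congr (_ *m m); rewrite mulmxBr mulmx1 /K /gain_of !mulmxA.
Qed.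

(** Equivalent to K Sg = F D H^T, the equation which makes the new error
    uncorrelated with the current output. *)
Lemma gain_orth D i : posdef D -> let K := gain_of D i in
  (ssF M i - K *m ssH M i) *m D *m (ssH M i)^T = K *m ssR M i.
Proof.
move=> hD K; have hS := posdef_innovation (ssH M i) hD (ssm_R_posdef hM i).
set Sg := _ + ssR M i in hS.
have KS : K *m Sg = ssF M i *m D *m (ssH M i)^T.
  by rewrite /K /gain_of mulmxKV ?posdef_unit.
by rewrite !mulmxBl -KS /Sg mulmxDr !mulmxA addrAC subrr add0r.
Qed.

(** The error recursion produces the covariance in the form on the left (the
    Joseph form), the Riccati equation in the form on the right. *)
Lemma joseph_form D i : posdef D ->
  let K := gain_of D i in let A := ssF M i - K *m ssH M i in
  A *m (D *m A^T) + K *m ssR M i *m K^T = ssF M i *m D *m (ssF M i)^T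
    - K *m (ssH M i *m D *m (ssH M i)^T + ssR M i) *m K^T.
Proof.
move=> hD K A; have hS := posdef_innovation (ssH M i) hD (ssm_R_posdef hM i).
set Sg := _ + ssR M i in hS *.
have KS : K *m Sg = ssF M i *m D *m (ssH M i)^T.
  by rewrite /K /gain_of mulmxKV ?posdef_unit.
have AF : A *m (D *m A^T) + K *m ssR M i *m K^T = A *m D *m (ssF M i)^T.
  rewrite -gain_orth// -/K -/A mulmxA -[X in _ + X]mulmxA -trmx_mul -mulmxDr.
  by rewrite -linearD /= /A subrK.
rewrite AF {1}/A !mulmxBl; congr (_ - _).
have -> : K *m ssH M i *m D *m (ssF M i)^T =
    K *m (ssF M i *m D *m (ssH M i)^T)^T.
  by rewrite !trmx_mul trmxK hD.1 !mulmxA.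
by rewrite -KS trmx_mul hS.1 mulmxA.
Qed.

Variables (y : nat -> 'cV[R]_q) (l : nat).

(** The matrix P_{i-1,i}^-1 that J contains comes from the penalty of the
    incoming edge when i > 0, and from the prior term of the local cost when
    i = 0; this is why both cases reduce to the same step. *)
Lemma pdmm_msg_kalman i : (i <= l)%N ->
  let K := gain_of (edgeP M i) i in
  pdmm_msg (kalman_qp M y l) (fun j => edgeP M j.+1) i =
  (ssF M i - K *m ssH M i) *m
    pdmm_in_msg (kalman_qp M y l) (fun j => edgeP M j.+1) i + K *m y i.
Proof.
move=> il K; rewrite /K; have hD := posdef_edgeP i.
have eGF j : (GF j)^T = col_mx (ssG M j)^T (ssF M j)^T by rewrite /GF tr_row_mx.
have AbT p (X : 'M[R]_(n, p)) :
    (@row_mx R n r n 0 1%:M)^T *m X = col_mx 0 X.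
  by rewrite tr_row_mx trmx0 trmx1 mul_col_mx mul0mx mul1mx.
have AbAb (X : 'M[R]_n) : (@row_mx R n r n 0 1%:M)^T *m X *m
    row_mx 0 1%:M = block_mx 0 0 0 X.
  by rewrite AbT mul_col_row !mulmx0 mul0mx mulmx1.
case: i il @K hD => [|i] il K hD.
  rewrite -(@pdmm_step _ 0%N 0 (y 0%N) hD) /= sub0r mulmx0 col_mx0 addr0.
  by rewrite eGF.
rewrite -(@pdmm_step _ i.+1 _ (y i.+1) hD) /= sub0r il AbAb AbT eGF addrA.
by rewrite mul_col_mx mul0mx add_block_mx !addr0.
Qed.

End KalmanPDMM.

(** * Conditional expectation and Gaussian regression *)

Section Condexp.
Context {R : realType} {d : measure_display} {Omega : measurableType d}.
Variable P : probability Omega R.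
Implicit Types (A : set Omega) (G : set (set Omega)) (X Y Z : Omega -> R).

Lemma sigma_measurable_lin G a b X Y : sigma_algebra setT G ->
  sigma_measurable G X -> sigma_measurable G Y ->
  sigma_measurable G (fun w => a * X w + b * Y w).
Proof.
move=> sG /(sigma_measurableP _ sG) mX /(sigma_measurableP _ sG) mY.
apply/(sigma_measurableP _ sG).
by apply: measurable_funD; exact: measurable_funM.
Qed.

Lemma sigma_measurable_cst G (c : R) : sigma_algebra setT G ->
  sigma_measurable G (fun=> c).
Proof. by move=> sG; apply/(sigma_measurableP _ sG); exact: measurable_cst. Qed.

Lemma integral_indic_Ex A X : measurable A -> integ P X ->
  (\int[P]_(w in A) (X w)%:E = (Ex P (fun w => X w * \1_A w))%:E)%E.
Proof.
move=> mA iX; rewrite EFin_Ex; last first.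
  by apply: integM_bounded => //; exact: bounded_indic.
rewrite integral_mkcond; apply: eq_integral => w _.
by rewrite patchE indicE; case: ifP => _; rewrite ?mulr1 ?mulr0.
Qed.

(** The event Z < Y belongs to G, so the two versions have the same integral over
    it, although their difference is positive there. *)
Lemma condexp_version_lt G X Y Z : sigma_algebra setT G ->
  G `<=` measurable -> is_condexp P G X Y -> is_condexp P G X Z ->
  {ae P, forall w, ~ (Z w < Y w)}.
Proof.
move=> sG Gm [GY iY hY] [GZ iZ hZ].
pose A := [set w | Z w < Y w].
have GA : G A.
  have h := sigma_measurable_lin 1 (-1) sG GY GZ.
  have := h `]0, +oo[%classic (measurable_itv _).
  congr G; apply/seteqP; split=> w; rewrite /A /= in_itv/= andbT.
    by rewrite mul1r mulN1r subr_gt0.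
  by rewrite mul1r mulN1r subr_gt0.
have mA := Gm _ GA.
have iD : integ P (fun w => Y w - Z w) by exact: integB.
have i0 : (\int[P]_(w in A) `|(Y w - Z w)%:E| = 0)%E.
  transitivity (\int[P]_(w in A) (Y w - Z w)%:E)%E.
    by apply: eq_integral => w /set_mem wA /=; rewrite gtr0_norm ?subr_gt0.
  under eq_integral do rewrite EFinB.
  rewrite integralB//=; [|exact: integrableS iY|exact: integrableS iZ].
  rewrite hY// hZ// subee// -hZ//.
  by apply: integrable_fin_num => //; exact: integrableS iZ.
have mD : measurable_fun A (EFin \o (fun w => Y w - Z w)).
  apply: measurable_funTS; apply/measurable_EFinP.
  exact: integ_measurable iD.
have := (ae_eq_integral_abs P mA mD).1 i0.
apply: filterS => w /= h wA.
have [] := h wA => /eqP; rewrite subr_eq0 => /eqP e.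
by move: wA; rewrite e ltxx.
Qed.

Lemma condexp_unique G X Y Z : sigma_algebra setT G -> G `<=` measurable ->
  is_condexp P G X Y -> is_condexp P G X Z -> {ae P, forall w, Y w = Z w}.
Proof.
move=> sG Gm hY hZ.
have h1 := condexp_version_lt sG Gm hY hZ.
have h2 := condexp_version_lt sG Gm hZ hY.
apply: filterS2 h1 h2 => w /negP h1 /negP h2.
by apply/eqP; rewrite eq_le !leNgt h1 h2.
Qed.

Lemma is_condexp_condexp G X Y : is_condexp P G X Y ->
  is_condexp P G X (condexp P G X).
Proof. by move=> hY; apply: xgetPex; exists Y. Qed.

Lemma is_condexp_orth G X Y : G `<=` measurable -> integ P X -> integ P Y ->
  sigma_measurable G Y ->
  (forall A, G A -> Ex P (fun w => (X w - Y w) * \1_A w) = 0) ->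
  is_condexp P G X Y.
Proof.
move=> Gm iX iY GY h; split => // A GA; have mA := Gm _ GA.
rewrite !integral_indic_Ex//; congr EFin.
have bA : bounded_rv (\1_A : Omega -> R) by exact: bounded_indic.
have := h A GA.
rewrite (@eq_Ex _ _ _ P _ (fun w => X w * \1_A w - Y w * \1_A w)).
  by rewrite ExB; [move=> /subr0_eq|exact: integM_bounded..].
by move=> w; rewrite mulrBl.
Qed.

End Condexp.

Section Regression.
Context {R : realType} {d : measure_display} {Omega : measurableType d}.
Variable P : probability Omega R.
Variables (A B : set (set Omega)) (G1 G2 : set (Omega -> R)).
Hypothesis sA : sigma_algebra setT A.
Hypothesis sB : sigma_algebra setT B.
Hypothesis AB : independent_sigma P A B.
Hypothesis g1 : gaussian_space P G1.
Hypothesis g2 : gaussian_space P G2.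
Hypothesis m1 : forall f, G1 f -> sigma_measurable A f.
Hypothesis m2 : forall f, G2 f -> sigma_measurable B f.
Hypothesis G10 : G1 (fun=> 0).
Hypothesis G20 : G2 (fun=> 0).

(** The initial state is independent of the noise but is not assumed jointly
    Gaussian with it, so all variables of the model are handled as a sum of an
    element of each space. *)
Definition sum_space : set (Omega -> R) :=
  [set f | exists S T, [/\ G1 S, G2 T & f = (fun w => S w + T w)]].

Lemma sum_space0 : sum_space (fun=> 0).
Proof.
by exists (fun=> 0), (fun=> 0); split => //; apply/funext => w; rewrite addr0.
Qed.

Lemma sum_spacel S : G1 S -> sum_space S.
Proof.
move=> GS; exists S, (fun=> 0); split => //.
by apply/funext => w; rewrite addr0.
Qed.

Lemma sum_spacer T : G2 T -> sum_space T.
Proof.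
move=> GT; exists (fun=> 0), T; split => //.
by apply/funext => w; rewrite add0r.
Qed.

Lemma sum_space_lin a b f g : sum_space f -> sum_space g ->
  sum_space (fun w => a * f w + b * g w).
Proof.
move=> [S [T [GS GT ->]]] [S' [T' [GS' GT' ->]]].
exists (fun w => a * S w + b * S' w), (fun w => a * T w + b * T' w); split.
- by case: g1 => h _; exact: h.
- by case: g2 => h _; exact: h.
- by apply/funext => w; ring.
Qed.

Lemma sum_space_L2 f : sum_space f -> L2 P f.
Proof.
move=> [S [T [GS GT ->]]].
have LS : L2 P S by case: g1 => _ /(_ _ GS)[].
have LT : L2 P T by case: g2 => _ /(_ _ GT)[].
have := L2_lin 1 1 LS LT.
by under eq_fun do rewrite !mul1r.
Qed.

(** For Gaussian variables the best linear predictor is the conditional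
    expectation: a residual X uncorrelated with the Y_i is orthogonal to every
    event that they generate. *)
Lemma gaussian_regression (I : Type) (Y : I -> Omega -> R) X (E : set Omega) :
  sum_space X -> (forall i, sum_space (Y i)) ->
  (forall i, Ex P (fun w => X w * Y i w) = 0) -> sigma_of Y E ->
  Ex P (fun w => X w * \1_E w) = 0.
Proof.
move=> WX WY XY YE.
(* The variables uncorrelated with X form a linear space containing the Y_i. *)
pose W := [set f | sum_space f /\ Ex P (fun w => X w * f w) = 0].
have LX := sum_space_L2 WX.
apply: (@trig_annihilates _ _ _ P X (L2_integ LX) W _ _ _ _ I Y) => //.
- split; first exact: sum_space0.
  by rewrite -[RHS](Ex_cst P); apply: eq_Ex => w; rewrite mulr0.
- move=> a b f g [Wf f0] [Wg g0]; split; first exact: sum_space_lin.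
  have i1 := L2M LX (sum_space_L2 Wf); have i2 := L2M LX (sum_space_L2 Wg).
  rewrite (@eq_Ex _ _ _ P _ (fun w => a * (X w * f w) + b * (X w * g w))).
    by rewrite ExD ?ExZ ?f0 ?g0 ?mulr0 ?addr0//; exact: integZ.
  by move=> w; ring.
- by move=> f [/sum_space_L2[]].
- move=> f c [[S [T [GS GT fE]]] Xf].
  move: WX Xf {XY}; rewrite fE => -[X1 [X2 [GX1 GX2 ->]]] Xf.
  apply: (indep_gaussian_cos sA sB AB g1 g2 m1 m2) => //.
  have G1_L2 h : G1 h -> L2 P h by case: g1 => _ k /k[].
  have G2_L2 h : G2 h -> L2 P h by case: g2 => _ k /k[].
  have i11 := L2M (G1_L2 _ GX1) (G1_L2 _ GS).
  have i22 := L2M (G2_L2 _ GX2) (G2_L2 _ GT).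
  have i12 := L2M (G1_L2 _ GX1) (G2_L2 _ GT).
  have i21 := L2M (G1_L2 _ GS) (G2_L2 _ GX2).
  move: Xf; rewrite (@eq_Ex _ _ _ P _ (fun w => (X1 w * S w + X2 w * T w) +
     (X1 w * T w + S w * X2 w))); last by move=> w; ring.
  rewrite ExD; [|exact: integD|exact: integD].
  rewrite [Ex P (fun w => X1 w * T w + _)]ExD// (ExD i11 i22).
  have e12 := indep_gaussian_ExM AB g1 g2 m1 m2 GX1 GT.
  have e21 := indep_gaussian_ExM AB g1 g2 m1 m2 GS GX2.
  by rewrite e12 e21 !addr0.
Qed.

End Regression.

(** * Matrices of second moments *)

Section CrossCovariance.
Context {R : realType} {d : measure_display} {Omega : measurableType d}.
Variable P : probability Omega R.

(** E[X Y^T], the cross-covariance of the centered vectors of the model. *)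
Definition cross_cov m p (X : Omega -> 'cV[R]_m) (Y : Omega -> 'cV[R]_p) :
    'M[R]_(m, p) :=
  map_mx fine (moment2 P X Y).

(** Every equation of the model and of the filter has this shape, which makes
    [cross_cov_linl] and [cross_cov_linr] the only rules of computation. *)
Definition mlin m p s (A : 'M[R]_(m, p)) (X : Omega -> 'cV[R]_p)
    (B : 'M[R]_(m, s)) (Y : Omega -> 'cV[R]_s) (w : Omega) : 'cV[R]_m :=
  A *m X w + B *m Y w.

Definition coords_in (V : set (Omega -> R)) m (X : Omega -> 'cV[R]_m) : Prop :=
  forall i, V (coord X i).

Lemma fine_expectation (f : Omega -> R) : fine ('E_P[f])%E = Ex P f.
Proof. by rewrite unlock. Qed.

Lemma cross_covE m p (X : Omega -> 'cV[R]_m) (Y : Omega -> 'cV[R]_p) i j :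
  cross_cov X Y i j = Ex P (fun w => coord X i w * coord Y j w).
Proof. by rewrite !mxE fine_expectation. Qed.

Lemma cross_cov_tr m p (X : Omega -> 'cV[R]_m) (Y : Omega -> 'cV[R]_p) :
  (cross_cov X Y)^T = cross_cov Y X.
Proof.
apply/matrixP => i j; rewrite mxE !cross_covE.
by apply: eq_Ex => w; rewrite mulrC.
Qed.

Lemma coord_mulmx m p (A : 'M[R]_(m, p)) (X : Omega -> 'cV[R]_p) i w :
  (A *m X w) i 0 = \sum_j A i j * coord X j w.
Proof. by rewrite mxE. Qed.

Lemma cross_cov_linl m p s t (A : 'M[R]_(m, p)) X (B : 'M[R]_(m, s)) Y
    (Z : Omega -> 'cV[R]_t) :
  coords_in (L2 P) X -> coords_in (L2 P) Y -> coords_in (L2 P) Z ->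
  cross_cov (mlin A X B Y) Z = A *m cross_cov X Z + B *m cross_cov Y Z.
Proof.
move=> LX LY LZ; apply/matrixP => i k; rewrite cross_covE !mxE.
under [X in _ = X + _]eq_bigr do rewrite cross_covE.
under [X in _ = _ + X]eq_bigr do rewrite cross_covE.
rewrite (@eq_Ex _ _ _ P _ (fun w => \sum_j A i j * (coord X j w * coord Z k w) +
  \sum_j B i j * (coord Y j w * coord Z k w))); last first.
  move=> w; rewrite {1}/coord /mlin mxE !coord_mulmx mulrDl !big_distrl /=.
  by congr (_ + _); apply: eq_bigr => j _; rewrite mulrA.
rewrite ExD; [|by apply: integ_sum => j; apply: integZ; exact: L2M..].
rewrite !Ex_sum; [|by move=> j; apply: integZ; exact: L2M..].
by congr (_ + _); apply: eq_bigr => j _; rewrite ExZ//; exact: L2M.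
Qed.

Lemma cross_cov_linr m p s t (A : 'M[R]_(m, p)) X (B : 'M[R]_(m, s)) Y
    (Z : Omega -> 'cV[R]_t) :
  coords_in (L2 P) X -> coords_in (L2 P) Y -> coords_in (L2 P) Z ->
  cross_cov Z (mlin A X B Y) = cross_cov Z X *m A^T + cross_cov Z Y *m B^T.
Proof.
move=> LX LY LZ.
by rewrite -cross_cov_tr cross_cov_linl// linearD /= !trmx_mul !cross_cov_tr.
Qed.

Lemma coords_in_mlin (V : set (Omega -> R)) m p s (A : 'M[R]_(m, p)) X
    (B : 'M[R]_(m, s)) Y :
  V (fun=> 0) ->
  (forall a b f g, V f -> V g -> V (fun w => a * f w + b * g w)) ->
  coords_in V X -> coords_in V Y -> coords_in V (mlin A X B Y).
Proof.
move=> V0 Vlin VX VY i.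
have Vsum k (c : 'I_k -> R) (F : 'I_k -> Omega -> R) : (forall j, V (F j)) ->
    V (fun w => \sum_j c j * F j w).
  move=> VF; have : forall u : seq 'I_k, V (fun w => \sum_(j <- u) c j * F j w).
    elim=> [|j u IH]; first by under eq_fun do rewrite big_nil.
    under eq_fun do rewrite big_cons -[X in _ + X]mul1r.
    exact: Vlin.
  exact.
have -> : coord (mlin A X B Y) i = (fun w => 1 * (\sum_j A i j * coord X j w) +
    1 * (\sum_j B i j * coord Y j w)).
  by apply/funext => w; rewrite {1}/coord /mlin mxE !coord_mulmx !mul1r.
by apply: Vlin; exact: Vsum.
Qed.

End CrossCovariance.

(** * The Kalman filter *)

Section KalmanFilter.
Context {R : realType} {d : measure_display} {Omega : measurableType d}.
Variable P : probability Omega R.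
Context {n r q : nat}.
Variables (M : ssm R n r q) (z : nat -> Omega -> 'cV[R]_n)
  (u : nat -> Omega -> 'cV[R]_r) (v y : nat -> Omega -> 'cV[R]_q).
Hypothesis hM : ssm_regular M.
Hypothesis hp : ssm_process P M z u v y.

Let V1 := lin_span (coord (z 0%N)).
Let V2 := lin_span (noise u v).

Let vmean_coord m (X : Omega -> 'cV[R]_m) : vmean P X = const_mx 0%E ->
  forall i, ('E_P[coord X i] = 0)%E.
Proof. by move=> /matrixP h i; have := h i 0; rewrite !mxE. Qed.

Let moment2_lty m (X : Omega -> 'cV[R]_m) (C : 'M[R]_m) :
  moment2 P X X = map_mx EFin C ->
  forall i, ('E_P[(fun w => coord X i w * coord X i w)%R] < +oo)%E.
Proof.
by move=> /matrixP h i; have := h i i; rewrite !mxE => ->; rewrite ltry.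
Qed.

Let g1 : gaussian_space P V1.
Proof.
apply: lin_span_gaussian (z0_gaussian hp) _ _.
  exact: vmean_coord (z0_mean hp).
exact: moment2_lty (z0_cov hp).
Qed.

Let g2 : gaussian_space P V2.
Proof.
apply: lin_span_gaussian (noise_gaussian hp) _ _.
  by move=> [[l i]|[l i]]; [exact: vmean_coord (u_mean hp l) i|
                            exact: vmean_coord (v_mean hp l) i].
by move=> [[l i]|[l i]]; [exact: moment2_lty (u_cov hp l l) i|
                          exact: moment2_lty (v_cov hp l l) i].
Qed.

Let s1 : sigma_algebra setT (sigma_of (coord (z 0%N))).
Proof. exact: smallest_sigma_algebra. Qed.

Let s2 : sigma_algebra setT (sigma_of (noise u v)).
Proof. exact: smallest_sigma_algebra. Qed.

Let m1 f : V1 f -> sigma_measurable (sigma_of (coord (z 0%N))) f.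
Proof. exact: lin_span_sigma_measurable. Qed.

Let m2 f : V2 f -> sigma_measurable (sigma_of (noise u v)) f.
Proof. exact: lin_span_sigma_measurable. Qed.

Let V10 : V1 (fun=> 0).
Proof. by exists [::]; apply/funext => w; rewrite big_nil. Qed.

Let V20 : V2 (fun=> 0).
Proof. by exists [::]; apply/funext => w; rewrite big_nil. Qed.

Let W := sum_space V1 V2.

Let W0 : W (fun=> 0). Proof. exact: sum_space0. Qed.

Let Wlin a b f g : W f -> W g -> W (fun w => a * f w + b * g w).
Proof. exact: sum_space_lin g1 g2 _ _ _ _. Qed.

Let WL2 m (X : Omega -> 'cV[R]_m) : coords_in W X -> coords_in (L2 P) X.
Proof. by move=> h i; exact: sum_space_L2 g1 g2 _ (h i). Qed.

Let Wmlin m p s (A : 'M[R]_(m, p)) X (B : 'M[R]_(m, s)) Y :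
  coords_in W X -> coords_in W Y -> coords_in W (mlin A X B Y).
Proof. exact: coords_in_mlin. Qed.

Let Wu l : coords_in W (u l).
Proof.
move=> i; apply: (sum_spacer V10).
exact: (lin_span_gen (noise u v) (inl (l, i))).
Qed.

Let Wv l : coords_in W (v l).
Proof.
move=> i; apply: (sum_spacer V10).
exact: (lin_span_gen (noise u v) (inr (l, i))).
Qed.

Let zS l : z l.+1 = mlin (ssF M l) (z l) (ssG M l) (u l).
Proof. by apply/funext => w; exact: state_eq hp l w. Qed.

Let yE l : y l = mlin (ssH M l) (z l) 1%:M (v l).
Proof. by apply/funext => w; rewrite /mlin mul1mx; exact: output_eq hp l w. Qed.

Let Wz l : coords_in W (z l).
Proof.
elim: l => [|l IH]; last by rewrite zS; exact: Wmlin.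
move=> i; apply: (sum_spacel V20); exact: (lin_span_gen (coord (z 0%N)) i).
Qed.

Let Wy l : coords_in W (y l).
Proof. by rewrite yE; exact: Wmlin. Qed.

Let Lu l := WL2 (Wu l).
Let Lv l := WL2 (Wv l).
Let Lz l := WL2 (Wz l).
Let Ly l := WL2 (Wy l).
#[local] Hint Resolve Lu Lv Lz Ly : core.

Let covuu l j : cross_cov P (u l) (u j) = ssQ M l *+ (l == j).
Proof.
by rewrite /cross_cov (u_cov hp); apply/matrixP => i k; rewrite !mxE.
Qed.

Let covvv l j : cross_cov P (v l) (v j) = ssR M l *+ (l == j).
Proof.
by rewrite /cross_cov (v_cov hp); apply/matrixP => i k; rewrite !mxE.
Qed.

Let covuv l j : cross_cov P (u l) (v j) = 0.
Proof.
by rewrite /cross_cov (uv_cov hp); apply/matrixP => i k; rewrite !mxE.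
Qed.

Let covvu l j : cross_cov P (v l) (u j) = 0.
Proof. by rewrite -cross_cov_tr covuv trmx0. Qed.

Let covz0 m (X : Omega -> 'cV[R]_m) : (forall i, V2 (coord X i)) ->
  cross_cov P (z 0%N) X = 0.
Proof.
move=> hX; apply/matrixP => i k; rewrite cross_covE mxE.
apply: (indep_gaussian_ExM (z0_indep hp) g1 g2 m1 m2) => //.
exact: (lin_span_gen (coord (z 0%N)) i).
Qed.

Let covzu j k : (j <= k)%N -> cross_cov P (z j) (u k) = 0.
Proof.
elim: j => [|j IH] jk.
  by apply: covz0 => i; exact: (lin_span_gen (noise u v) (inl (k, i))).
rewrite zS cross_cov_linl ?IH ?covuu// 1?ltnW//.
by rewrite mulmx0 add0r ltn_eqF// mulr0n mulmx0.
Qed.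

Let covzv j k : cross_cov P (z j) (v k) = 0.
Proof.
elim: j => [|j IH].
  by apply: covz0 => i; exact: (lin_span_gen (noise u v) (inr (k, i))).
by rewrite zS cross_cov_linl ?IH ?covuv// !mulmx0 addr0.
Qed.

Let D i := edgeP M i.
Let K i := gain_of M (D i) i.

(** The Kalman filter driven by the deterministic matrices P_{k-1,k} instead of
    error covariances defined from conditional expectations; this breaks the
    circularity between the gain and the estimate. *)
Fixpoint kalman_rec (k : nat) : Omega -> 'cV[R]_n :=
  if k is l.+1 then
    mlin (ssF M l - K l *m ssH M l) (kalman_rec l) (K l) (y l)
  else fun=> 0.

Notation zh := kalman_rec.

Let Wzh k : coords_in W (zh k).
Proof.
elim: k => [|k IH] /=; last exact: Wmlin.
move=> i; rewrite (_ : coord _ _ = fun=> 0)//.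
by apply/funext => w; rewrite /coord mxE.
Qed.

Let Lzh l := WL2 (Wzh l).
#[local] Hint Resolve Lzh : core.

Let covyu j k : (j <= k)%N -> cross_cov P (y j) (u k) = 0.
Proof.
move=> jk; rewrite yE cross_cov_linl ?covzu ?covvu//.
by rewrite !mulmx0 addr0.
Qed.

Let covyv j k : (j < k)%N -> cross_cov P (y j) (v k) = 0.
Proof.
move=> jk; rewrite yE cross_cov_linl ?covzv ?covvv//.
by rewrite ltn_eqF// mulr0n !mulmx0 addr0.
Qed.

Let cov0 m p (X : Omega -> 'cV[R]_m) : cross_cov P (fun=> 0 : 'cV[R]_p) X = 0.
Proof.
apply/matrixP => i k; rewrite cross_covE mxE -[RHS](Ex_cst P).
by apply: eq_Ex => w; rewrite /coord mxE mul0r.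
Qed.

Let covzhu j k : (j <= k)%N -> cross_cov P (zh j) (u k) = 0.
Proof.
elim: j => [|j IH] jk /=; first exact: cov0.
rewrite cross_cov_linl ?IH ?covyu// 1?ltnW//.
by rewrite !mulmx0 addr0.
Qed.

Let covzhv j k : (j <= k)%N -> cross_cov P (zh j) (v k) = 0.
Proof.
elim: j => [|j IH] jk /=; first exact: cov0.
rewrite cross_cov_linl ?IH ?covyv// 1?ltnW//.
by rewrite !mulmx0 addr0.
Qed.

Let err k := mlin 1%:M (z k) (- 1%:M) (zh k).

Let Werr k : coords_in W (err k).
Proof. exact: Wmlin. Qed.

(** The fresh noise entering the error between times k and k + 1. *)
Let noise_err k := mlin (ssG M k) (u k) (- K k) (v k).

Let Wne k : coords_in W (noise_err k).
Proof. exact: Wmlin. Qed.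

Let errS k : err k.+1 =
  mlin (ssF M k - K k *m ssH M k) (err k) 1%:M (noise_err k).
Proof.
apply/funext => w; rewrite /err zS /= yE /noise_err /mlin.
rewrite !mul1mx !mulNmx !mul1mx.
rewrite mulmxBr mulmxDr !mulmxA.
rewrite [(ssF M k - _) *m z k w]mulmxBl.
move: (_ *m zh k w) (ssF M k *m z k w) (ssG M k *m u k w) (_ *m v k w).
move=> a b c e.
by apply/matrixP => i j; rewrite !mxE; ring.
Qed.

Let Lerr l := WL2 (Werr l).
Let Lne l := WL2 (Wne l).
#[local] Hint Resolve Lerr Lne : core.

Let coverr k m (X : Omega -> 'cV[R]_m) : coords_in (L2 P) X ->
  cross_cov P (z k) X = 0 -> cross_cov P (zh k) X = 0 ->
  cross_cov P (err k) X = 0.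
Proof.
by move=> LX h1 h2; rewrite /err cross_cov_linl// h1 h2 !mulmx0 addr0.
Qed.

Let covnn k : cross_cov P (noise_err k) (noise_err k) =
  ssG M k *m ssQ M k *m (ssG M k)^T + K k *m ssR M k *m (K k)^T.
Proof.
rewrite {1}/noise_err cross_cov_linl// /noise_err !cross_cov_linr//.
rewrite covuu covvv covuv covvu.
rewrite eqxx !mulr1n !mul0mx addr0 add0r mulmxA.
by rewrite [(- K k)^T]raddfN /= mulmxN mulNmx mulmxN opprK mulmxA.
Qed.

Let cov_err_noise k : cross_cov P (err k) (noise_err k) = 0.
Proof.
rewrite /noise_err cross_cov_linr// coverr// ?covzu ?covzhu//.
rewrite coverr// ?covzv ?covzhv//.
by rewrite !mul0mx addr0.
Qed.

Let cov_noise_err k : cross_cov P (noise_err k) (err k) = 0.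
Proof. by rewrite -cross_cov_tr cov_err_noise trmx0. Qed.

Let cov_errS k m (X : Omega -> 'cV[R]_m) : coords_in (L2 P) X ->
  cross_cov P (err k.+1) X =
  (ssF M k - K k *m ssH M k) *m cross_cov P (err k) X
  + cross_cov P (noise_err k) X.
Proof. by move=> LX; rewrite errS cross_cov_linl// mul1mx. Qed.

(** The three properties are proved together: the new error is uncorrelated with
    y_k because y_k is the innovation H e_k + v_k, for which the gain is tuned,
    plus H times the estimate; and the estimate is a combination of past
    outputs. *)
Lemma err_cov k :
  [/\ cross_cov P (err k) (err k) = D k, cross_cov P (err k) (zh k) = 0 &
   forall j, (j < k)%N -> cross_cov P (err k) (y j) = 0].
Proof.
elim: k => [|k [IH1 IH2 IH3]].
  have e0 : err 0 = z 0%N.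
    by apply/funext => w; rewrite /err /mlin mul1mx mulmx0 addr0.
  split => //; last by rewrite -cross_cov_tr cov0 trmx0.
  by rewrite e0 /cross_cov (z0_cov hp); apply/matrixP => i j; rewrite !mxE.
have orth m (X : Omega -> 'cV[R]_m) : coords_in (L2 P) X ->
    cross_cov P (err k) X = 0 -> cross_cov P X (u k) = 0 ->
    cross_cov P X (v k) = 0 ->
    cross_cov P (err k.+1) X = 0.
  move=> LX h1 h2 h3.
  have hu : cross_cov P (u k) X = 0 by rewrite -cross_cov_tr h2 trmx0.
  have hv : cross_cov P (v k) X = 0 by rewrite -cross_cov_tr h3 trmx0.
  rewrite cov_errS// h1 /noise_err cross_cov_linl// hu hv.
  by rewrite !(mulmx0, addr0).
have ozh : cross_cov P (err k.+1) (zh k) = 0.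
  by apply: orth => //; [exact: covzhu|exact: covzhv].
have oy : cross_cov P (err k.+1) (y k) = 0.
  (* Innovation plus predicted output. *)
  have ye : y k =
      mlin 1%:M (mlin (ssH M k) (err k) 1%:M (v k)) (ssH M k) (zh k).
    apply/funext => w; rewrite yE /err /mlin !mul1mx !mulNmx !mul1mx mulmxBr.
    by apply/matrixP => i j; rewrite !mxE; ring.
  have Lm : coords_in (L2 P) (mlin (ssH M k) (err k) 1%:M (v k)).
    exact/WL2/Wmlin.
  rewrite ye cross_cov_linr// ozh mul0mx addr0 trmx1 mulmx1 cross_cov_linr//.
  have ev : cross_cov P (err k) (v k) = 0.
    by apply: coverr; [|exact: covzv|exact: covzhv].
  have nv : cross_cov P (noise_err k) (v k) = - K k *m ssR M k.
    by rewrite /noise_err cross_cov_linl// covuv covvv eqxx mulr1n mulmx0 add0r.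
  rewrite trmx1 mulmx1 !cov_errS// IH1 cov_noise_err ev nv mulmx0 addr0 add0r.
  by rewrite gain_orth ?mulNmx ?subrr//; exact: posdef_edgeP.
split.
- have h : cross_cov P (err k) (err k.+1) = D k *m (ssF M k - K k *m ssH M k)^T.
    rewrite -cross_cov_tr cov_errS// IH1 cov_noise_err addr0 trmx_mul.
    by rewrite (posdef_edgeP hM k).1.
  have h2 : cross_cov P (noise_err k) (err k.+1) =
      cross_cov P (noise_err k) (noise_err k).
    by rewrite -cross_cov_tr cov_errS// cov_err_noise mulmx0 add0r cross_cov_tr.
  rewrite cov_errS// h h2 covnn /D edgeP_riccati// -/(D k) -/(K k).
  have J := joseph_form hM k (posdef_edgeP hM k).
  rewrite -/(D k) -/(K k) /= in J.
  by rewrite addrCA J addrA [ssG M k *m _ *m _ + _]addrC.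
- by rewrite /= cross_cov_linr// ozh oy !mul0mx addr0.
- move=> j; rewrite ltnS leq_eqVlt => /predU1P[->//|jk].
  apply: orth => //; first exact: IH3.
    by apply: covyu; exact: ltnW.
  exact: covyv.
Qed.

Let sigma_obs_algebra l : sigma_algebra setT (sigma_obs y l).
Proof. exact: smallest_sigma_algebra. Qed.

Let sigma_obs_measurable l : sigma_obs y l `<=` measurable.
Proof.
apply: smallest_sub; first exact: sigma_algebra_measurable.
move=> _ [k _ [E mE <-]].
by case: (Ly k.1 k.2) => my _; exact: my.
Qed.

Let coord_y_obs l j : (j <= l)%N ->
  coords_in (sigma_measurable (sigma_obs y l)) (y j).
Proof.
move=> jl i E mE; apply: sub_sigma_algebra.
have jl' : (j < l.+1)%N by [].
by exists (Ordinal jl', i) => //; exists E => //; rewrite setTI.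
Qed.

Let zh_obs l k : (k <= l.+1)%N ->
  coords_in (sigma_measurable (sigma_obs y l)) (zh k).
Proof.
elim: k => [|k IH] kl /=.
  move=> i; rewrite (_ : coord _ _ = fun=> 0); last first.
    by apply/funext => w; rewrite /coord mxE.
  exact: sigma_measurable_cst.
apply: coords_in_mlin.
- exact: sigma_measurable_cst.
- by move=> a b f g; exact: sigma_measurable_lin.
- by apply: IH; exact: ltnW.
- exact: coord_y_obs.
Qed.

(** The recursion is measurable with respect to the outputs, and its error is
    uncorrelated with them. *)
Lemma kalman_rec_condexp l i :
  is_condexp P (sigma_obs y l) (coord (z l.+1) i) (coord (zh l.+1) i).
Proof.
apply: is_condexp_orth.
- exact: sigma_obs_measurable.
- exact: L2_integ (Lz _ _).
- exact: L2_integ (Lzh _ _).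
- exact: zh_obs.
move=> E hE; have [_ _ oy] := err_cov l.+1.
rewrite -[RHS](gaussian_regression s1 s2 (z0_indep hp) g1 g2 m1 m2 V10 V20
  (Werr l.+1 i) _ _ hE).
- apply: eq_Ex => w; congr (_ * _).
  by rewrite /coord /err /mlin mul1mx mulNmx mul1mx !mxE.
- by move=> [j k]; exact: Wy.
- move=> [j k] /=; have /matrixP/(_ i k) := oy j (ltn_ord j).
  by rewrite cross_covE mxE.
Qed.

Lemma kf_est_kalman_rec k : {ae P, forall w, kf_est P z y k w = zh k w}.
Proof.
case: k => [|l]; first exact: aeW.
have h i : {ae P, forall w, condexp P (sigma_obs y l) (coord (z l.+1) i) w =
    coord (zh l.+1) i w}.
  apply: condexp_unique (sigma_obs_algebra l) (@sigma_obs_measurable l) _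
    (kalman_rec_condexp l i).
  exact: is_condexp_condexp (kalman_rec_condexp l i).
have ha : {ae P, forall w, forall i,
    condexp P (sigma_obs y l) (coord (z l.+1) i) w = coord (zh l.+1) i w}.
  exact: filter_forall h.
apply: filterS ha => w hw.
by apply/colP => i; rewrite mxE hw.
Qed.

Lemma kf_cov_edgeP k : kf_cov P z y k = edgeP M k.
Proof.
have [e _ _] := err_cov k; rewrite -[edgeP M k]e.
apply/matrixP => i j; rewrite !cross_covE.
have me i' : measurable_fun setT (coord (kf_err P z y k) i').
  have -> : coord (kf_err P z y k) i' =
      (fun w => coord (z k) i' w - coord (kf_est P z y k) i' w).
    by apply/funext => w; rewrite /coord /kf_err !mxE.
  apply: measurable_funB; first by case: (Lz k i').
  case: (k) => [|l].
    rewrite (_ : coord _ _ = fun=> 0)//.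
    by apply/funext => w; rewrite /coord mxE.
  rewrite (_ : coord _ _ = condexp P (sigma_obs y l) (coord (z l.+1) i')).
    have := is_condexp_condexp (kalman_rec_condexp l i').
    by move=> [_ /integ_measurable].
  by apply/funext => w; rewrite /coord mxE.
have mr i' : measurable_fun setT (coord (err k) i') by case: (Lerr k i').
apply: ae_eq_Ex; [exact: measurable_funM|exact: measurable_funM|].
apply: filterS (kf_est_kalman_rec k) => w hw.
by rewrite /coord /kf_err hw /err /mlin mul1mx mulNmx mul1mx.
Qed.

Lemma kf_gain_edgeP k : kf_gain P M z y k = gain_of M (edgeP M k) k.
Proof. by rewrite /kf_gain kf_cov_edgeP. Qed.

Lemma pdmm_msg_kalman_rec l i w : (i <= l)%N ->
  pdmm_msg (kalman_qp M (fun j => y j w) l) (fun j => edgeP M j.+1) i =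
  zh i.+1 w.
Proof.
elim: i => [|i IH] il; rewrite pdmm_msg_kalman//.
rewrite -[RHS]/(mlin _ (zh i.+1) _ (y i.+1) w) /mlin -(IH (ltnW il)).
by [].
Qed.

End KalmanFilter.

Theorem theorem5 (R : realType) (d : measure_display)
    (Omega : measurableType d) (P : probability Omega R) (n r q : nat)
    (M : ssm R n r q) (z : nat -> Omega -> 'cV[R]_n)
    (u : nat -> Omega -> 'cV[R]_r) (v y : nat -> Omega -> 'cV[R]_q)
    (hM : ssm_regular M) (hproc : ssm_process P M z u v y) (l : nat) :
  let Pe := fun i => edgeP M i.+1 in
  let K := kf_gain P M z y in
  (forall (ym : nat -> 'cV[R]_q) (i : nat), (i <= l)%N ->
     pdmm_msg (kalman_qp M ym l) Pe i =
     (ssF M i - K i *m ssH M i) *m pdmm_in_msg (kalman_qp M ym l) Pe i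
     + K i *m ym i) /\
  (forall i : nat, (i <= l)%N ->
     {ae P, forall w, pdmm_msg (kalman_qp M (fun j => y j w) l) Pe i =
                      kf_est P z y i.+1 w}).
Proof.
move=> Pe K; split=> [ym i il|i il].
  by rewrite /K (kf_gain_edgeP hM hproc) pdmm_msg_kalman.
apply: filterS (kf_est_kalman_rec hM hproc i.+1) => w ->.
by rewrite pdmm_msg_kalman_rec.
Qed.
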